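(* Let $C>1$ be a constant such that for every real $Z>0$ and every cubic field $K$ with $|\Delta(K)|\le Z$, the set $S_K(CZ^{1/4})$ is nonempty. Let $X,Y>0$ be real numbers with $Y\geq CX^{1/4}$. Then for every $\epsilon>0$, \[ \sum_{\substack{[K:\mathbb{Q}]=3\\ |\Delta(K)|\leq X}}|S_K(Y)|\ll_\epsilon X^{1/2+\epsilon}Y^2, \] where the sum is over cubic fields up to isomorphism and the implied constant depends only on $C$ (and $\epsilon$).
   Context: For a cubic field $K$ with ring of integers $\mathcal{O}_K$ and discriminant $\Delta(K)$, an element $\alpha\in\mathcal{O}_K$ is reduced if its trace lies in $\{-1,0,1\}$; $|\alpha|_\infty=\max_{v\mid\infty}|\alpha|_v$ (maximum of $|\tau(\alpha)|$ over complex embeddings $\tau$); for $Y>0$, $S_K(Y)$ is the set of reduced $\alpha\in\mathcal{O}_K\setminus\mathbb{Z}$ with $|\alpha|_\infty<Y$. *)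

(* Defs.v *)
From HB Require Import structures.
From mathcomp Require Import all_boot all_order all_algebra.
From mathcomp Require Import reals exp.
From mathcomp.real_closed Require Import complex.
From Stdlib Require Import ClassicalEpsilon.

Set Implicit Arguments.
Unset Strict Implicit.
Unset Printing Implicit Defensive.

Import Order.TTheory GRing.Theory Num.Theory.
Local Open Scope ring_scope.

(* A cubic field K is presented as Q[x]/(f) for an irreducible cubic
   f in Q[x].  Elements of K are represented by their unique reduced
   representatives g in Q[x] with deg g < 3 (size g <= 3); the element
   is the class of g, i.e. "g(theta)" with theta the class of x.        *)

Definition cubic (f : {poly rat}) : Prop :=
  size f = 4%N /\ irreducible_poly f.

Definition K_elt (g : {poly rat}) : bool := (size g <= 3)%N.

(* Ring of integers: alpha = g(theta) is a root of a monic integer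
   polynomial p, i.e. p(g(x)) = 0 in Q[x]/(f).                           *)
Definition in_OK (f g : {poly rat}) : Prop :=
  exists p : {poly int}, p \is monic /\ f %| (map_poly intr p \Po g).

Definition in_Z (g : {poly rat}) : Prop :=
  exists z : int, g = (z%:~R)%:P.

(* Isomorphism of the fields Q[x]/(f1) and Q[x]/(f2): mutually inverse
   Q-algebra homomorphisms, x |-> g(x) : K2 -> K1 and x |-> h(x) : K1 -> K2. *)
Definition iso_fields (f1 f2 : {poly rat}) : Prop :=
  exists g h : {poly rat},
    [/\ f1 %| (f2 \Po g), f2 %| (f1 \Po h),
        f1 %| ((h \Po g) - 'X) & f2 %| ((g \Po h) - 'X)].

Definition integral_basis (f : {poly rat}) (w : 'I_3 -> {poly rat}) : Prop :=
  [/\ forall i, K_elt (w i) /\ in_OK f (w i),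
      forall g, K_elt g -> in_OK f g ->
        exists c : 'I_3 -> int, g = \sum_(i < 3) (c i)%:~R *: w i
    & forall c : 'I_3 -> int, \sum_(i < 3) (c i)%:~R *: w i = 0 ->
        forall i, c i = 0].

Section Embeddings.
Variable R : realType.

Definition ratC (q : rat) : R[i] := ratr q.

(* The complex conjugates of theta: the roots (with multiplicity) of f in C.
   The complex embeddings of K send theta to these roots. *)
Definition conj_roots (f : {poly rat}) : seq R[i] :=
  sval (closed_field_poly_normal (map_poly ratC f)).

Definition embeds (f g : {poly rat}) : seq R[i] :=
  [seq (map_poly ratC g).[z] | z <- conj_roots f].

Definition trK (f g : {poly rat}) : R[i] := \sum_(x <- embeds f g) x.

Definition cabs (x : R[i]) : R := complex.Re `|x|.

Definition abs_inf (f g : {poly rat}) : R :=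
  foldr Num.max 0 [seq cabs x | x <- embeds f g].

Definition discK (f : {poly rat}) : R[i] :=
  epsilon (inhabits 0) (fun d : R[i] => exists w, integral_basis f w /\
    d = (\det (\matrix_(i < 3, j < 3)
                 (map_poly ratC (w i)).[nth 0 (conj_roots f) j])) ^+ 2).

Definition in_S (f : {poly rat}) (Y : R) (g : {poly rat}) : Prop :=
  [/\ K_elt g, in_OK f g, ~ in_Z g,
      trK f g \in [:: -1; 0; 1] & abs_inf f g < Y].

End Embeddings.

(* Main.v *)
Require Import Defs.
From HB Require Import structures.
From mathcomp Require Import all_boot all_order all_algebra.
From Stdlib Require Import ClassicalEpsilon.
From mathcomp Require Import boolp reals exp.
From mathcomp.real_closed Require Import complex.
From mathcomp Require Import all_field.
From mathcomp Require Import ring lra zify.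
Import Order.TTheory GRing.Theory Num.Theory.
Local Open Scope ring_scope.

(* For a cubic field K of discriminant D, let T be the diameter of the set of
   conjugates of a primitive element alpha of O_K / Z obtained from a reduced
   element of S_K(C |D|^(1/4)), so that T^2 << sqrt |D|.  Complete alpha to an
   integral basis 1, alpha, beta with beta reduced modulo alpha, so that beta
   has diameter << sqrt |D| / T.  The index form
     F(x, y) = prod_(i < j) (x (alpha_i - alpha_j) + y (beta_i - beta_j)) / sqrt D
   has integer coefficients of sizes << T^3 / sqrt |D|, T, sqrt |D| / T, |D| / T^3
   and determines K.  So do the forms attached to beta + k alpha, and for
   k <= sqrt |D| / T^2 they are distinct and satisfy the same bounds; since such a
   box has volume << |D|, there are << T^2 sqrt |D| fields with D and T in given
   dyadic intervals.  Each of them has << (Y / T) (Y T / sqrt |D| + 1) elements in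
   S_K(Y), which gives << sqrt X Y^2 for each of the O(log X)^2 pairs of dyadic
   intervals. *)

(** With a single form per field, the box count would give [<< |D|] fields for every [T]. That is
    too weak when [T] is small, exactly where a field can have the most reduced elements; the number
    of shifts grows as [T] decreases and makes up for this.

    A form determines its field for the following reason. By the multiplication table,
    [(beta_3 - beta_2) / (alpha_3 - alpha_2)] equals [(e - alpha_1) / a] with an integer [e]. So a
    zero of [F(x, -1)] is a primitive element of [K], and a common zero polynomial of degree 3 gives
    an isomorphism.

    Lattice points of a box are bounded by its volume only if no side is short. The outer
    coefficients of [F] are nonzero integers because conjugates are distinct, so their bounds are at
    least 1; the bounds of the inner ones are at least 1 because [1 <= T] and [T^2 << sqrt |D|].

    Diameters replace absolute values because they do not see translation by [Z]. The trace
    condition enters only in the count within one field. The existence hypothesis is applied with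
    [Z = |D|] itself, so the basis depends on [K] alone and not on [X]. *)

Set Implicit Arguments.
Unset Strict Implicit.
Unset Printing Implicit Defensive.

(** * Evaluation at complex conjugates *)

Section Evaluation.
Variable C : numFieldType.

Definition ev (z : C) (g : {poly rat}) : C := (map_poly ratr g).[z].

Lemma evD z g h : ev z (g + h) = ev z g + ev z h.
Proof. by rewrite /ev rmorphD hornerD. Qed.

Lemma evB z g h : ev z (g - h) = ev z g - ev z h.
Proof. by rewrite /ev rmorphB hornerD hornerN. Qed.

Lemma evM z g h : ev z (g * h) = ev z g * ev z h.
Proof. by rewrite /ev rmorphM hornerM. Qed.

Lemma evC z q : ev z q%:P = ratr q.
Proof. by rewrite /ev map_polyC /= hornerC. Qed.

Lemma ev_int z (n : int) : ev z (n%:~R)%:P = n%:~R.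
Proof. by rewrite evC ratr_int. Qed.

Lemma evX z : ev z 'X = z.
Proof. by rewrite /ev map_polyX hornerX. Qed.

Lemma evZ z q g : ev z (q *: g) = ratr q * ev z g.
Proof. by rewrite -mul_polyC evM evC. Qed.

Lemma ev_sum z n (F : 'I_n -> {poly rat}) :
  ev z (\sum_i F i) = \sum_i ev z (F i).
Proof.
elim/big_ind2: _ => [|g x h y <- <-|//]; last exact: evD.
by rewrite -polyC0 evC rmorph0.
Qed.

Lemma ev_comp z g h : ev z (g \Po h) = ev (ev z h) g.
Proof. by rewrite /ev map_comp_poly horner_comp. Qed.

Lemma ev_dvd z f h : ev z f = 0 -> f %| h -> ev z h = 0.
Proof.
by move=> fz /Pdiv.Field.dvdpP[q ->]; rewrite evM fz mulr0.
Qed.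

(** Otherwise [f] and [h] are coprime, and a Bezout relation evaluated at [z] reads [0 = 1]. *)
Lemma dvd_ev z f h : irreducible_poly f -> ev z f = 0 -> ev z h = 0 -> f %| h.
Proof.
move=> irrf fz hz; apply: contraT => nfh.
have cop : coprimep f h by rewrite irreducible_poly_coprime.
have /Bezout_eq1_coprimepP[[u v] /= Huv] := cop.
have /eqP : ev z (u * f + v * h) = 1 by rewrite Huv -polyC1 evC rmorph1.
by rewrite evD !evM fz hz !mulr0 addr0 eq_sym oner_eq0.
Qed.

Lemma ev_modp z f h : ev z f = 0 -> ev z (h %% f) = ev z h.
Proof. by move=> fz; rewrite {2}(divp_eq h f) evD evM fz mulr0 add0r. Qed.

Lemma ev_size3 z (g : {poly rat}) : (size g <= 3)%N ->
  ev z g = ratr g`_0 + ratr g`_1 * z + ratr g`_2 * z ^+ 2.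
Proof.
move=> sg; rewrite /ev (@horner_coef_wide _ 3).
  by rewrite !big_ord_recl big_ord0 /= !coef_map /=; ring.
by rewrite size_map_poly.
Qed.

Definition integralC (x : C) : Prop := integralOver (intr : int -> C) x.

Lemma integralC_int (n : int) : integralC n%:~R.
Proof. exact: integral_id. Qed.

(** Irreducibility lets one root stand for the class of [x], so closure of integral elements under
    ring operations can be used in [C]. *)
Lemma integralC_ev z f g : irreducible_poly f -> ev z f = 0 ->
  in_OK f g <-> integralC (ev z g).
Proof.
move=> irrf fz.
have E (p : {poly int}) : ev z (map_poly intr p \Po g) = (map_poly intr p).[ev z g].
  rewrite ev_comp /ev -map_poly_comp; congr (_.[_]).
  by apply: eq_map_poly => n /=; rewrite ratr_int.
split=> [[p [mp fp]]|[p mp /rootP rp]]; exists p => //.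
  by apply/rootP; rewrite -E; exact: ev_dvd fp.
by split=> //; apply: (@dvd_ev z) => //; rewrite E.
Qed.

(** The monic equation descends to the rationals and is then read in [algC], where a rational
    algebraic integer is an integer. *)
Lemma integralC_rat (q : rat) : integralC (ratr q) -> exists n : int, q = n%:~R.
Proof.
case=> p mp /rootP rp.
have : (map_poly intr p).[q] = 0.
  apply: (fmorph_inj (ratr : rat -> C)); rewrite rmorph0 -rp -horner_map /=.
  rewrite -map_poly_comp; congr (_.[_]).
  by apply: eq_map_poly => n /=; rewrite ratr_int.
move=> pq.
have /Cint_rat_Aint : (ratr q : algC) \in Crat by exact: Crat_rat.
have qA : (ratr q : algC) \in Aint.
  have mp' : map_poly (intr : int -> algC) p \is monic by rewrite monic_map.
  apply: (root_monic_Aint _ mp').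
    rewrite /root; apply/eqP.
    transitivity (ratr (map_poly intr p).[q] : algC); last by rewrite pq rmorph0.
    rewrite -horner_map /= -map_poly_comp; congr (_.[_]).
    by apply: eq_map_poly => n /=; rewrite ratr_int.
  by apply/polyOverP => i; rewrite coef_map /= rpred_int.
move=> /(_ qA) /intrP[n Hn]; exists n.
by apply: (fmorph_inj (ratr : rat -> algC)); rewrite /= ratr_int; exact: Hn.
Qed.

End Evaluation.

Lemma conjc_ratr (R : realType) q : conjc (ratr q : R[i]) = ratr q.
Proof. by rewrite fmorph_rat. Qed.

Lemma conjc_ev (R : realType) (z : R[i]) g : conjc (ev z g) = ev (conjc z) g.
Proof.
rewrite /ev -horner_map /= -map_poly_comp; congr (_.[_]).
by apply: eq_map_poly => q /=; rewrite conjc_ratr.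
Qed.

(** The determinant with rows [(1, 1, 1)], [(a_i)], [(b_i)]; it ignores constants added to the last
    two rows. *)
Definition det3 (A : comPzRingType) (a1 a2 a3 b1 b2 b3 : A) : A :=
  (a2 - a1) * (b3 - b1) - (a3 - a1) * (b2 - b1).

(** * Roots of an irreducible cubic and values of polynomials at them *)

Section Roots.
Variable C : numFieldType.
Implicit Types (f g h : {poly rat}) (z : C).

Lemma cubic_dvd_small f h : cubic f -> f %| h -> (size h <= 3)%N -> h = 0.
Proof.
move=> [sf irrf] fh sh; apply/eqP; apply: contraT => h0.
by have := dvdp_leq h0 fh; rewrite sf leqNgt ltnS sh.
Qed.

Definition roots3 f z1 z2 z3 : Prop :=
  forall x, ev x f = ratr f`_3 * ((x - z1) * (x - z2) * (x - z3)).

Lemma roots3_rot f z1 z2 z3 : roots3 f z1 z2 z3 -> roots3 f z2 z3 z1.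
Proof. by move=> H x; rewrite H; ring. Qed.

Lemma roots3_1 f z1 z2 z3 : roots3 f z1 z2 z3 -> ev z1 f = 0.
Proof. by move=> H; rewrite H; ring. Qed.

Lemma cubic_coef3 f : cubic f -> f`_3 != 0.
Proof.
by case=> sf _; rewrite -[f`_3]/(f`_(4.-1)) -sf -lead_coefE lead_coef_eq0 -size_poly_eq0 sf.
Qed.

Lemma ev_size4 z f : (size f <= 4)%N ->
  ev z f = ratr f`_0 + ratr f`_1 * z + ratr f`_2 * z ^+ 2 + ratr f`_3 * z ^+ 3.
Proof.
move=> sg; rewrite /ev (@horner_coef_wide _ 4).
  by rewrite !big_ord_recl big_ord0 /= !coef_map /=; ring.
by rewrite size_map_poly.
Qed.

Lemma vieta f z1 z2 z3 : cubic f -> roots3 f z1 z2 z3 ->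
  [/\ z1 + z2 + z3 = ratr (- f`_2 / f`_3),
      z1 * z2 + z1 * z3 + z2 * z3 = ratr (f`_1 / f`_3)
    & z1 * z2 * z3 = ratr (- f`_0 / f`_3)].
Proof.
move=> cf H; have [sf irrf] := cf.
have l0 : ratr f`_3 != 0 :> C by rewrite fmorph_eq0 cubic_coef3.
(* The cubic terms of [G] cancel, so its three remaining coefficients are read off the values at 0,
   1 and -1. *)
pose G x := ratr f`_0 + ratr f`_1 * x + ratr f`_2 * x ^+ 2 + ratr f`_3 * x ^+ 3
  - ratr f`_3 * ((x - z1) * (x - z2) * (x - z3)).
have G0 x : G x = 0 by rewrite /G -H ev_size4 ?sf ?subrr.
have n2 : (2 : C) != 0 by rewrite pnatr_eq0.
have E2 : ratr f`_2 + ratr f`_3 * (z1 + z2 + z3) = 0.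
  apply: (mulfI n2); transitivity (G 1 + G (- 1) - 2 * G 0); first by rewrite /G; ring.
  by rewrite !G0; ring.
have E1 : ratr f`_1 - ratr f`_3 * (z1 * z2 + z1 * z3 + z2 * z3) = 0.
  apply: (mulfI n2); transitivity (G 1 - G (- 1)); first by rewrite /G; ring.
  by rewrite !G0; ring.
have E0 : ratr f`_0 + ratr f`_3 * (z1 * z2 * z3) = 0.
  by rewrite -(G0 0) /G; ring.
split; rewrite fmorph_div ?rmorphN; apply: (canRL (mulfK l0)).
- by apply/eqP; rewrite eq_sym eqr_oppLR -addr_eq0 mulrC E2.
- by apply/eqP; rewrite eq_sym -subr_eq0 mulrC E1.
- by apply/eqP; rewrite eq_sym eqr_oppLR -addr_eq0 mulrC E0.
Qed.

Definition vand (A : comPzRingType) (x1 x2 x3 : A) : A :=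
  (x2 - x1) * (x3 - x1) * (x3 - x2).

Lemma vandE (A : comPzRingType) (x1 x2 x3 : A) :
  det3 x1 x2 x3 (x1 * x1) (x2 * x2) (x3 * x3) = vand x1 x2 x3.
Proof. by rewrite /det3 /vand; ring. Qed.

Lemma vand_sqr_rat f z1 z2 z3 : cubic f -> roots3 f z1 z2 z3 ->
  exists q : rat, vand z1 z2 z3 ^+ 2 = ratr q.
Proof.
move=> cf H; have [] := vieta cf H.
move: (- f`_2 / f`_3) (f`_1 / f`_3) (- f`_0 / f`_3) => s1 s2 s3 E1 E2 E3.
(* The classical discriminant of a monic cubic in the elementary symmetric functions of its
   roots. *)
exists (s1 ^+ 2 * s2 ^+ 2 - s2 ^+ 3 *+ 4 - (s1 ^+ 3 * s3) *+ 4 - s3 ^+ 2 *+ 27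
  + (s1 * s2 * s3) *+ 18).
rewrite !rmorphD !rmorphN !rmorphMn !rmorphM /= -E1 -E2 -E3 /vand.
by ring.
Qed.

(** A double root would be a root of the derivative, forcing [f] to divide a polynomial of smaller
    degree whose coefficient of degree 2 is [3 f_3], not zero. *)
Lemma roots3_neq f z1 z2 z3 : cubic f -> roots3 f z1 z2 z3 -> z1 != z2.
Proof.
move=> cf H; have [sf irrf] := cf; apply/eqP => E.
have d0 : ev z1 f^`() = 0.
  have l0 : ratr f`_3 != 0 :> C by rewrite fmorph_eq0 cubic_coef3.
  have [e1 e2 _] := vieta cf H; rewrite -E in e1 e2.
  have F1 : ratr f`_1 = (z1 * z1 + z1 * z3 + z1 * z3) * ratr f`_3 :> C.
    by rewrite e2 fmorph_div divfK.
  have F2 : ratr f`_2 = - (z1 + z1 + z3) * ratr f`_3 :> C.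
    by rewrite e1 fmorph_div rmorphN /= mulNr divfK // opprK.
  rewrite ev_size3; last by rewrite -ltnS -sf lt_size_deriv // -size_poly_eq0 sf.
  rewrite !coef_deriv !rmorphMn /= F1 F2.
  by ring.
have fd : f %| f^`() by apply: (dvd_ev irrf (roots3_1 H)).
have : f^`() = 0.
  by apply: (cubic_dvd_small cf fd); rewrite -ltnS -sf lt_size_deriv // -size_poly_eq0 sf.
move=> /(congr1 (fun p : {poly rat} => p`_2)); rewrite coef_deriv coef0.
by move/eqP; rewrite mulrn_eq0 /= (negPf (cubic_coef3 cf)).
Qed.

Lemma size3_eqP (g h : {poly rat}) : (size g <= 3)%N -> (size h <= 3)%N ->
  g`_0 = h`_0 -> g`_1 = h`_1 -> g`_2 = h`_2 -> g = h.
Proof.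
move=> sg sh e0 e1 e2; apply/polyP => -[|[|[|i]]] //.
by rewrite !nth_default // (leq_trans _ (isT : 3 <= i.+3)%N).
Qed.

(** Equal values would make [z1 + z2] rational, hence also [z3] since the sum of the roots is
    rational, and [f] would have a linear multiple. *)
Lemma ev_neq f z1 z2 z3 g : cubic f -> roots3 f z1 z2 z3 -> (size g <= 3)%N ->
  (g`_1 != 0) || (g`_2 != 0) -> ev z1 g != ev z2 g.
Proof.
move=> cf H sg nc; have [sf irrf] := cf; apply/eqP => E.
have z12 := roots3_neq cf H.
have {}E : ratr g`_1 + ratr g`_2 * (z1 + z2) = 0 :> C.
  apply: (mulfI (_ : z1 - z2 != 0)); first by rewrite subr_eq0.
  rewrite mulr0 -(subrr (ev z2 g)) -{1}E !ev_size3 //; ring.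
have g2 : g`_2 != 0.
  apply/negP => /eqP g2; move: nc E; rewrite g2 eqxx orbF rmorph0 mul0r addr0.
  by move=> nc /eqP; rewrite fmorph_eq0 (negPf nc).
have rg2 : ratr g`_2 != 0 :> C by rewrite fmorph_eq0.
have [e1 _ _] := vieta cf H.
have z3q : z3 = ratr (- f`_2 / f`_3 + g`_1 / g`_2).
  rewrite rmorphD /= -e1 fmorph_div /=; apply: (mulfI rg2).
  rewrite mulrDr mulrCA divff // mulr1 -[LHS]addr0 -E; ring.
have fX : f %| 'X - (- f`_2 / f`_3 + g`_1 / g`_2)%:P.
  apply: (@dvd_ev _ z3) => //; first exact: roots3_1 (roots3_rot (roots3_rot H)).
  by rewrite evB evX evC -z3q subrr.
have := cubic_dvd_small cf fX; rewrite size_XsubC => /(_ isT) /eqP.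
by rewrite polyXsubC_eq0.
Qed.

Lemma det3_ev z1 z2 z3 g h : (size g <= 3)%N -> (size h <= 3)%N ->
  det3 (ev z1 g) (ev z2 g) (ev z3 g) (ev z1 h) (ev z2 h) (ev z3 h) =
  ratr (g`_1 * h`_2 - h`_1 * g`_2) * vand z1 z2 z3.
Proof.
move=> sg sh; rewrite !ev_size3 // rmorphB !rmorphM /det3 /vand; ring.
Qed.

(** Cramer's rule on the coefficients of degrees 1 and 2, whose rational minor is the determinant
    divided by the Vandermonde product. *)
Lemma det3_solve z1 z2 z3 (u v g : {poly rat}) :
  (size u <= 3)%N -> (size v <= 3)%N -> (size g <= 3)%N ->
  det3 (ev z1 u) (ev z2 u) (ev z3 u) (ev z1 v) (ev z2 v) (ev z3 v) != 0 ->
  exists r s t : rat, g = r%:P + s *: u + t *: v.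
Proof.
move=> su sv sg; rewrite det3_ev // mulf_eq0 fmorph_eq0 => /norP[m0 _].
set m := (X in X != 0) in m0.
pose s := (g`_1 * v`_2 - v`_1 * g`_2) / m.
pose t := (u`_1 * g`_2 - g`_1 * u`_2) / m.
exists (g`_0 - s * u`_0 - t * v`_0), s, t.
apply: size3_eqP => //.
- rewrite (leq_trans (size_polyD _ _)) // geq_max (leq_trans (size_polyD _ _)).
    by rewrite (leq_trans (size_scale_leq _ _)).
  rewrite geq_max (leq_trans (size_polyC_leq1 _)) //.
  by rewrite (leq_trans (size_scale_leq _ _)).
- by rewrite !coefD !coefZ coefC /=; ring.
- by rewrite !coefD !coefZ coefC /= /s /t /m; field.
- by rewrite !coefD !coefZ coefC /= /s /t /m; field.
Qed.

End Roots.

Lemma conj_rootsE (R : realType) (f : {poly rat}) : cubic f ->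
  exists z1 z2 z3, conj_roots R f = [:: z1; z2; z3] /\ roots3 f z1 z2 z3.
Proof.
move=> cf; have [sf irrf] := cf.
rewrite /conj_roots; case: (closed_field_poly_normal _) => s /= Es.
have lc : lead_coef (map_poly (ratC R) f) = ratr f`_3.
  by rewrite /ratC lead_coef_map lead_coefE sf.
have l0 : ratr f`_3 != 0 :> R[i] by rewrite fmorph_eq0 cubic_coef3.
have : size (map_poly (ratC R) f) = 4 by rewrite /ratC size_map_poly.
rewrite {1}Es lc size_scale // size_prod_XsubC => -[ss].
move: s ss Es => [|z1 [|z2 [|z3 [|]]]] //= _ Es.
exists z1, z2, z3; split=> // x.
by rewrite /ev Es lc hornerZ !big_cons big_nil !hornerM !hornerXsubC hornerC; ring.
Qed.

(** * Fields generated by a root of the same cubic *)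

Section CommonRoot.
Variable C : numFieldType.
Implicit Types (f g h P q : {poly rat}) (z : C).

Definition nonconst g : bool := (g`_1 != 0) || (g`_2 != 0).

Lemma ev_neq3 f z1 z2 z3 g : cubic f -> roots3 f z1 z2 z3 -> (size g <= 3)%N ->
  nonconst g ->
  [/\ ev z1 g != ev z2 g, ev z2 g != ev z3 g & ev z3 g != ev z1 g].
Proof.
move=> cf H sg ng; split.
- exact: ev_neq cf H sg ng.
- exact: ev_neq cf (roots3_rot H) sg ng.
- exact: ev_neq cf (roots3_rot (roots3_rot H)) sg ng.
Qed.

Lemma vand_neq0 (x1 x2 x3 : C) : x1 != x2 -> x2 != x3 -> x3 != x1 ->
  vand x1 x2 x3 != 0.
Proof.
move=> n1 n2 n3; rewrite /vand !mulf_neq0 // subr_eq0 //.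
  by rewrite eq_sym.
by rewrite eq_sym.
Qed.

(** [P] acts as minimal polynomial of [g(theta)]: if [q] kills [g(theta)], the remainder of [q]
    modulo [P] has degree at most 2 and vanishes at three distinct conjugates. *)
Lemma annihilator_dvd f g P q z1 z2 z3 : cubic f -> roots3 f z1 z2 z3 ->
  (size g <= 3)%N -> nonconst g -> size P = 4%N -> ev (ev z1 g) P = 0 ->
  (f %| q \Po g) = (P %| q).
Proof.
move=> cf H sg ng sP Pz; have [sf irrf] := cf.
have [e1 e2 e3] := And3 (roots3_1 H) (roots3_1 (roots3_rot H))
  (roots3_1 (roots3_rot (roots3_rot H))).
apply/idP/idP => [fq|Pq]; last first.
  by apply: (dvd_ev irrf e1); rewrite ev_comp; exact: ev_dvd Pz Pq.
have fP : f %| P \Po g by apply: (dvd_ev irrf e1); rewrite ev_comp.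
have W z : ev z f = 0 -> ev (ev z g) (q %% P) = 0.
  by move=> z0; rewrite ev_modp -ev_comp ?(ev_dvd z0 fP) // (ev_dvd z0 fq).
apply/modp_eq0P; apply/eqP.
have [n1 n2 n3] := ev_neq3 cf H sg ng.
apply: contraT => r0.
have := @max_poly_roots C (map_poly ratr (q %% P)) [:: ev z1 g; ev z2 g; ev z3 g].
rewrite map_poly_eq0 r0 /= !inE negb_or n1 n2 (eq_sym (ev z1 g)) n3 /= => /(_ isT).
have {}W z : ev z f = 0 -> root (map_poly ratr (q %% P)) (ev z g).
  by move=> /W z0; apply/eqP.
rewrite !W //= => /(_ isT isT).
have P0 : P != 0 by rewrite -size_poly_eq0 sP.
have : (size (q %% P)%R < 4)%N by rewrite -sP ltn_modp.
by rewrite size_map_poly ltnS leqNgt => /negPf ->.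
Qed.

(** The determinant of [1, g, g^2] is the Vandermonde product of distinct conjugates, so [x] is a
    rational combination of them. *)
Lemma primitive_elt f g z1 z2 z3 : cubic f -> roots3 f z1 z2 z3 ->
  (size g <= 3)%N -> nonconst g -> exists h, ev (ev z1 g) h = z1.
Proof.
move=> cf H sg ng; have [sf irrf] := cf.
have [e1 e2 e3] := And3 (roots3_1 H) (roots3_1 (roots3_rot H))
  (roots3_1 (roots3_rot (roots3_rot H))).
have f0 : f != 0 by rewrite -size_poly_eq0 sf.
have sm h : (size (h %% f)%R <= 3)%N by rewrite -ltnS -sf ltn_modp.
have [n1 n2 n3] := ev_neq3 cf H sg ng.
have [||r [s [t E]]] := @det3_solve _ z1 z2 z3 g ((g * g) %% f) 'X sg (sm _).
- by rewrite size_polyX.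
- by rewrite !ev_modp // !evM vandE vand_neq0.
exists (r%:P + s *: 'X + t *: ('X * 'X)).
have := congr1 (ev z1) E; rewrite evX !evD evC !evZ ev_modp // evM => Ez.
by rewrite evM !evX evC -Ez.
Qed.

(** The elements [g1(z1)] and [g2(y1)] are annihilated by the same polynomials, the multiples of
    [P]. Each generates its field, so relations carry over in both directions and sending one to the
    other is an isomorphism. *)
Lemma iso_of_common_root f1 f2 g1 g2 P (z1 z2 z3 y1 y2 y3 : C) :
  cubic f1 -> cubic f2 -> roots3 f1 z1 z2 z3 -> roots3 f2 y1 y2 y3 ->
  (size g1 <= 3)%N -> nonconst g1 -> (size g2 <= 3)%N -> nonconst g2 ->
  size P = 4%N -> ev (ev z1 g1) P = 0 -> ev (ev y1 g2) P = 0 ->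
  iso_fields f1 f2.
Proof.
move=> cf1 cf2 H1 H2 sg1 ng1 sg2 ng2 sP P1 P2.
have [_ irr1] := cf1; have [_ irr2] := cf2.
have e1 := roots3_1 H1; have e2 := roots3_1 H2.
have [h1 E1] := primitive_elt cf1 H1 sg1 ng1.
have [h2 E2] := primitive_elt cf2 H2 sg2 ng2.
have tr12 q : ev (ev z1 g1) q = 0 -> ev (ev y1 g2) q = 0.
  rewrite -ev_comp => z0; have := dvd_ev irr1 e1 z0.
  rewrite (annihilator_dvd q cf1 H1 sg1 ng1 sP P1).
  by rewrite -(annihilator_dvd q cf2 H2 sg2 ng2 sP P2) -ev_comp; exact: ev_dvd.
have tr21 q : ev (ev y1 g2) q = 0 -> ev (ev z1 g1) q = 0.
  rewrite -ev_comp => z0; have := dvd_ev irr2 e2 z0.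
  rewrite (annihilator_dvd q cf2 H2 sg2 ng2 sP P2).
  by rewrite -(annihilator_dvd q cf1 H1 sg1 ng1 sP P1) -ev_comp; exact: ev_dvd.
exists (h2 \Po g1), (h1 \Po g2); split.
- by apply: (dvd_ev irr1 e1); rewrite !ev_comp -ev_comp; apply: tr21;
    rewrite ev_comp E2.
- by apply: (dvd_ev irr2 e2); rewrite !ev_comp -ev_comp; apply: tr12;
    rewrite ev_comp E1.
- apply: (dvd_ev irr1 e1); rewrite evB !ev_comp evX.
  have /tr21 : ev (ev y1 g2) (g2 \Po h2 - 'X) = 0.
    by rewrite evB ev_comp E2 evX subrr.
  by rewrite evB ev_comp evX => /eqP; rewrite subr_eq0 => /eqP ->; rewrite E1 subrr.
- apply: (dvd_ev irr2 e2); rewrite evB !ev_comp evX.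
  have /tr12 : ev (ev z1 g1) (g1 \Po h1 - 'X) = 0.
    by rewrite evB ev_comp E1 evX subrr.
  by rewrite evB ev_comp evX => /eqP; rewrite subr_eq0 => /eqP ->; rewrite E2 subrr.
Qed.

End CommonRoot.

(** * Integral bases and the discriminant *)

Lemma ex_minP (P : nat -> Prop) :
  (exists n, P n) -> exists2 n, P n & forall m, P m -> (n <= m)%N.
Proof.
move=> [n0 Pn0]; have exP : exists n, `[< P n >] by exists n0; apply/asboolP.
by case: (ex_minnP exP) => n /asboolP Pn Hn; exists n => // m Pm; apply/Hn/asboolP.
Qed.

Section IntegralBasis.
Variable C : numFieldType.
Variables (f : {poly rat}) (z1 z2 z3 : C).
Hypothesis (cf : cubic f) (H : roots3 f z1 z2 z3).
Implicit Types (g h k : {poly rat}) (z : C).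

Definition ev_det g h : C :=
  det3 (ev z1 g) (ev z2 g) (ev z3 g) (ev z1 h) (ev z2 h) (ev z3 h).

Definition isOK g : Prop := (size g <= 3)%N /\ in_OK f g.

Let irrf : irreducible_poly f := proj2 cf.
Let e1 : ev z1 f = 0 := roots3_1 H.
Let e2 : ev z2 f = 0 := roots3_1 (roots3_rot H).
Let e3 : ev z3 f = 0 := roots3_1 (roots3_rot (roots3_rot H)).
Let intOK z g : ev z f = 0 -> in_OK f g -> integralC (ev z g).
Proof. by move=> z0 /(integralC_ev g irrf z0). Qed.

Lemma in_OK_sub g h : in_OK f g -> in_OK f h -> in_OK f (g - h).
Proof.
move=> g1 h1; apply/(integralC_ev _ irrf e1); rewrite evB.
by apply: integral_sub; apply: intOK.
Qed.

Lemma in_OK_mul g h : in_OK f g -> in_OK f h -> in_OK f (g * h).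
Proof.
move=> g1 h1; apply/(integralC_ev _ irrf e1); rewrite evM.
by apply: integral_mul; apply: intOK.
Qed.

Lemma in_OK_modp g : in_OK f g -> in_OK f (g %% f).
Proof.
by move=> g1; apply/(integralC_ev _ irrf e1); rewrite ev_modp //; apply: intOK.
Qed.

Lemma in_OK_int (n : int) : in_OK f (n%:~R)%:P.
Proof. by apply/(integralC_ev _ irrf e1); rewrite ev_int; apply: integralC_int. Qed.

Lemma in_OK_scale (n : int) g : in_OK f g -> in_OK f (n%:~R *: g).
Proof. by move=> g1; rewrite -mul_polyC; apply: in_OK_mul => //; apply: in_OK_int. Qed.

Lemma in_OK_rat (q : rat) : in_OK f q%:P -> exists n : int, q = n%:~R.
Proof. by move=> /(intOK e1); rewrite evC => /integralC_rat. Qed.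

Lemma isOK_comb (m n : int) g h : isOK g -> isOK h ->
  isOK (m%:~R *: g - n%:~R *: h).
Proof.
move=> [sg Og] [sh Oh]; split; last by apply: in_OK_sub; apply: in_OK_scale.
rewrite (leq_trans (size_polyD _ _)) // geq_max size_polyN.
by rewrite !(leq_trans (size_scale_leq _ _)).
Qed.

(** The square is integral, and it is rational because it is a rational square times the
    discriminant of the roots. *)
Lemma ev_det_sqr_int g h : isOK g -> isOK h -> exists n : int, ev_det g h ^+ 2 = n%:~R.
Proof.
move=> [sg Og] [sh Oh].
have iD : integralC (ev_det g h ^+ 2).
  rewrite expr2; apply: integral_mul; rewrite /ev_det /det3;
    by do ?[apply: integral_sub | apply: integral_mul | exact: intOK].
have [q qE] := vand_sqr_rat cf H.
have E : ev_det g h ^+ 2 = ratr ((g`_1 * h`_2 - h`_1 * g`_2) ^+ 2 * q).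
  by rewrite /ev_det det3_ev // exprMn qE rmorphM rmorphXn.
by rewrite E in iD *; have [n ->] := integralC_rat iD; exists n; rewrite ratr_int.
Qed.

Lemma vand_f_neq0 : vand z1 z2 z3 != 0.
Proof.
apply: vand_neq0; first exact: roots3_neq cf H.
  exact: roots3_neq cf (roots3_rot H).
exact: roots3_neq cf (roots3_rot (roots3_rot H)).
Qed.

Lemma integral_multiple : exists2 a : int, a != 0 & in_OK f (a%:~R *: 'X).
Proof.
have [q [a a0 fE]] := rat_poly_scale f.
have q3 : q`_3 != 0.
  have := cubic_coef3 cf; rewrite fE coefZ coef_map /= mulf_eq0 negb_or.
  by rewrite intr_eq0 => /andP[].
exists q`_3 => //; apply/(integralC_ev _ irrf e1); rewrite evZ evX ratr_int.
have qz : (q`_0)%:~R + (q`_1)%:~R * z1 + (q`_2)%:~R * z1 ^+ 2 + (q`_3)%:~R * z1 ^+ 3 = 0 :> C.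
  have fi i : ratr f`_i = ratr (a%:~R^-1) * (q`_i)%:~R :> C.
    by rewrite fE coefZ coef_map rmorphM /= ratr_int.
  have : ratr (a%:~R^-1) != 0 :> C by rewrite fmorph_eq0 invr_eq0 intr_eq0.
  move: (ratr _) fi => b fi b0.
  have := e1; rewrite ev_size4; last by case: cf => ->.
  by rewrite !fi -!mulrA -!mulrDr => /eqP; rewrite mulf_eq0 (negPf b0) => /eqP.
(* Multiplying [q(z1) = 0] by [q_3^2] gives a monic equation for [q_3 z1]. *)
pose s := [:: q`_0 * q`_3 ^+ 2; q`_1 * q`_3; q`_2; 1].
exists (Poly s).
  by rewrite monicE lead_coefE (@PolyK _ 0).
apply/rootP; rewrite map_Poly horner_Poly /= rmorph1 !rmorphM /=.
transitivity ((q`_3)%:~R ^+ 2 * ((q`_0)%:~R + (q`_1)%:~R * z1 + (q`_2)%:~R * z1 ^+ 2 + (q`_3)%:~R * z1 ^+ 3)).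
  by ring.
by rewrite qz mulr0.
Qed.

Lemma exists_indep : exists g h, [/\ isOK g, isOK h & ev_det g h != 0].
Proof.
have [a a0 Oa] := integral_multiple.
exists (a%:~R *: 'X), ((a * a)%:~R *: 'X^2); split.
- by split=> //; rewrite (leq_trans (size_scale_leq _ _)) ?size_polyX.
- split; first by rewrite (leq_trans (size_scale_leq _ _)) ?size_polyXn.
  suff -> : (a * a)%:~R *: 'X^2 = (a%:~R *: 'X) * (a%:~R *: 'X) :> {poly rat}.
    exact: in_OK_mul.
  by rewrite -scalerAl -scalerAr scalerA intrM expr2.
rewrite /ev_det det3_ev ?(leq_trans (size_scale_leq _ _)) ?size_polyX ?size_polyXn //.
rewrite !coefZ !coefX !coefXn /= mulf_neq0 ?vand_f_neq0 // fmorph_eq0.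
by rewrite !mulr1 !mulr0 subr0 mulf_neq0 // intr_eq0 // mulf_neq0.
Qed.

(* Such a pair completes 1 to an integral basis: replacing a coordinate by its
   fractional part would give a smaller nonzero determinant. *)
Definition min_pair g h : Prop :=
  [/\ isOK g, isOK h, ev_det g h != 0
    & forall g' h', isOK g' -> isOK h' -> ev_det g' h' != 0 ->
      `|ev_det g h| <= `|ev_det g' h'| ].

(** Squared determinants are integers, so their absolute values attain a least nonzero value. *)
Lemma exists_min_pair : exists g h, min_pair g h.
Proof.
have [g0 [h0 [Og0 Oh0 n0]]] := exists_indep.
pose P m := exists g h n, [/\ isOK g, isOK h, ev_det g h != 0, ev_det g h ^+ 2 = n%:~R
  & absz n = m].
have [|m [g [h [n [Og Oh nz En <-]]]] Hm] := @ex_minP P.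
  by have [n En] := ev_det_sqr_int Og0 Oh0; exists (absz n), g0, h0, n.
exists g, h; split=> // g' h' Og' Oh' nz'.
rewrite -(@ler_pXn2r _ 2) // ?nnegrE //.
have [n' En'] := ev_det_sqr_int Og' Oh'.
rewrite -!normrX En En' -!intr_norm ler_int.
have : (absz n <= absz n')%N by apply: Hm; exists g', h', n'.
by rewrite -!abszE.
Qed.

Lemma ev_det_subl g g' h : ev_det (g - g') h = ev_det g h - ev_det g' h.
Proof. by rewrite /ev_det !evB /det3; ring. Qed.

Lemma ev_det_combl (r s t : rat) g h : ev_det (r%:P + s *: g + t *: h) h = ratr s * ev_det g h.
Proof. by rewrite /ev_det !evD !evC !evZ /det3; ring. Qed.

Lemma ev_det_combr (r s t : rat) g h : ev_det g (r%:P + s *: g + t *: h) = ratr t * ev_det g h.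
Proof. by rewrite /ev_det !evD !evC !evZ /det3; ring. Qed.

Lemma ltr_norm_fract (s : rat) : `|ratr (s - (Num.floor s)%:~R)| < 1 :> C.
Proof.
have /andP[l u] := floor_itv s.
rewrite ger0_norm; last by rewrite ler0q subr_ge0.
by rewrite -(rmorph1 (ratr : rat -> C)) ltr_rat ltrBlDl (lt_le_trans u) // intrD.
Qed.

Lemma min_pair_basis g h k : min_pair g h -> isOK k ->
  exists r s t : int, k = (r%:~R)%:P + s%:~R *: g + t%:~R *: h.
Proof.
move=> [Og Oh nz minP] Ok; have [sk Ok'] := Ok.
have [r [s [t Ek]]] := det3_solve (proj1 Og) (proj1 Oh) sk nz.
have contract (q : rat) g' h' : isOK g' -> isOK h' ->
    ev_det g' h' = ratr (q - (Num.floor q)%:~R) * ev_det g h -> q = (Num.floor q)%:~R.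
  move=> Og' Oh' E; have lt1 := ltr_norm_fract q.
  apply/eqP; rewrite -subr_eq0; apply: contraT => nq.
  have := minP _ _ Og' Oh'; rewrite E mulf_neq0 ?fmorph_eq0 // => /(_ isT).
  by rewrite normrM ler_pMl ?normr_gt0 // lt_geF.
have [s' Es] : exists s' : int, s = s'%:~R.
  exists (Num.floor s); apply: (contract s (1%:~R *: k - (Num.floor s)%:~R *: g) h) => //.
    exact: isOK_comb.
  rewrite scale1r ev_det_subl Ek ev_det_combl rmorphB mulrBl; congr (_ - _).
  by rewrite /ev_det !evZ /det3; ring.
have [t' Et] : exists t' : int, t = t'%:~R.
  exists (Num.floor t); apply: (contract t g (1%:~R *: k - (Num.floor t)%:~R *: h)) => //.
    exact: isOK_comb.
  have -> u v : ev_det g (u - v) = ev_det g u - ev_det g v by rewrite /ev_det !evB /det3; ring.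
  rewrite scale1r Ek ev_det_combr rmorphB mulrBl; congr (_ - _).
  by rewrite /ev_det !evZ /det3; ring.
subst s t.
(* With integer coordinates on [g] and [h], the constant coordinate is a rational integral element,
   hence an integer. *)
have : in_OK f r%:P.
  have -> : r%:P = k - s'%:~R *: g - t'%:~R *: h by rewrite Ek; ring.
  by apply: in_OK_sub; [apply: in_OK_sub => //|]; apply: in_OK_scale;
    [case: Og|case: Oh].
by move=> /in_OK_rat[r' Er]; exists r', s', t'; rewrite Ek Er.
Qed.

End IntegralBasis.

Lemma det_mx33 (A : comPzRingType) (F : nat -> nat -> A) :
  \det (\matrix_(i < 3, j < 3) F i j) =
    F 0%N 0%N * (F 1%N 1%N * F 2%N 2%N - F 1%N 2%N * F 2%N 1%N)
  - F 0%N 1%N * (F 1%N 0%N * F 2%N 2%N - F 1%N 2%N * F 2%N 0%N)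
  + F 0%N 2%N * (F 1%N 0%N * F 2%N 1%N - F 1%N 1%N * F 2%N 0%N).
Proof.
rewrite (expand_det_row _ ord0) !big_ord_recl big_ord0 /cofactor.
rewrite !(expand_det_row _ ord0) !big_ord_recl !big_ord0 /cofactor !det_mx11.
rewrite !mxE /= /bump /= !add0n !addn0 ?add1n ?addn1 /=.
rewrite !expr0 !expr1 !mul1r sqrrN expr1n !mul1r; ring.
Qed.

(** * Independence of the discriminant from the integral basis *)

Section Discriminant.
Variable R : realType.
Variables (f : {poly rat}) (z1 z2 z3 : R[i]).
Hypotheses (cf : cubic f) (H : roots3 f z1 z2 z3).
Hypothesis Ez : conj_roots R f = [:: z1; z2; z3].

Let z (j : nat) : R[i] := nth 0 [:: z1; z2; z3] j.

Definition embmx (w : 'I_3 -> {poly rat}) : 'M[R[i]]_3 :=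
  \matrix_(i < 3, j < 3) ev (z j) (w i).

Lemma embmx_int_comb w w' (B : 'I_3 -> 'I_3 -> int) :
  (forall i, w i = \sum_(k < 3) (B i k)%:~R *: w' k) ->
  embmx w = map_mx intr (\matrix_(i, k) B i k) *m embmx w'.
Proof.
move=> E; apply/matrixP => i j; rewrite !mxE E ev_sum.
by apply: eq_bigr => k _; rewrite evZ !mxE ratr_int.
Qed.

Lemma integral_basis_det w w' : integral_basis f w -> integral_basis f w' ->
  exists n : int, \det (embmx w) = n%:~R * \det (embmx w').
Proof.
move=> [w1 _ _] [_ w2 _].
have /(_ _)/cid-/all_sig[B EB] i : exists c : 'I_3 -> int,
    w i = \sum_(k < 3) (c k)%:~R *: w' k.
  by have [] := w1 i; exact: w2.
exists (\det (\matrix_(i, k) B i k)).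
by rewrite (embmx_int_comb EB) det_mulmx det_map_mx.
Qed.

Section MinPair.
Variables g h : {poly rat}.
Hypothesis mp : min_pair f z1 z2 z3 g h.

Definition basis3 (i : nat) : {poly rat} := nth 0 [:: 1; g; h] i.

Lemma sum_basis3 (c : 'I_3 -> int) : \sum_(i < 3) (c i)%:~R *: basis3 i =
  ((c ord0)%:~R)%:P + (c (inord 1))%:~R *: g + (c (inord 2))%:~R *: h.
Proof.
rewrite !big_ord_recl big_ord0 /basis3 /= addr0 addrA alg_polyC.
by congr (_ + (c _)%:~R *: _ + (c _)%:~R *: _); apply: val_inj; rewrite /= inordK.
Qed.

Lemma min_pair_integral_basis : integral_basis f (fun i : 'I_3 => basis3 i).
Proof.
have [Og Oh nz _] := mp; split.
- move=> [[|[|[|//]]] ?] //=; rewrite /basis3 /=; split=> //.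
    by rewrite /K_elt size_poly1.
  exact: (in_OK_int cf H 1).
- move=> k sk Ok; have [r [s [t E]]] := min_pair_basis cf H mp (conj sk Ok).
  exists (fun i => nth 0 [:: r; s; t] i).
  by rewrite sum_basis3 /= !inordK.
move=> c; rewrite sum_basis3 => E.
have E1 : c (inord 1) = 0.
  have := ev_det_combl z1 z2 z3 (c ord0)%:~R (c (inord 1))%:~R (c (inord 2))%:~R g h.
  rewrite E -(scale0r g) /ev_det !evZ rmorph0 !mul0r /det3 !subrr !mul0r subr0.
  move/eqP; rewrite eq_sym mulf_eq0 (negPf nz) orbF ratr_int intr_eq0.
  by move/eqP.
have E2 : c (inord 2) = 0.
  have := ev_det_combr z1 z2 z3 (c ord0)%:~R (c (inord 1))%:~R (c (inord 2))%:~R g h.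
  rewrite E -(scale0r g) /ev_det !evZ rmorph0 !mul0r /det3 !subrr !mulr0 subr0.
  move/eqP; rewrite eq_sym mulf_eq0 (negPf nz) orbF ratr_int intr_eq0.
  by move/eqP.
move: E; rewrite E1 E2 !scale0r !addr0 => /eqP; rewrite polyC_eq0 intr_eq0 => /eqP E0.
move=> i; have D : [\/ i = ord0, i = inord 1 | i = inord 2].
  case: i => [[|[|[|//]]] ?]; [apply: Or31|apply: Or32|apply: Or33];
    by apply: val_inj; rewrite /= ?inordK.
by case: D => ->.
Qed.

Lemma embmx_basis3 : \det (embmx (fun i : 'I_3 => basis3 i)) = ev_det z1 z2 z3 g h.
Proof.
rewrite /embmx (@det_mx33 _ (fun i j => ev (z j) (basis3 i))) /= /basis3 /=.
have ev1 x : ev x 1 = 1 :> R[i] by rewrite -polyC1 evC rmorph1.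
by rewrite /ev_det /det3 !ev1 /z /=; move: (ev _ _) => *; ring.
Qed.

(** [epsilon] selects an unknown basis. Integer matrices change it into [1, g, h] and back; their
    determinants multiply to 1, so each squares to 1. *)
Lemma discKE : discK R f = ev_det z1 z2 z3 g h ^+ 2.
Proof.
pose P (d : R[i]) := exists w, integral_basis f w /\ d = \det (embmx w) ^+ 2.
have EP : discK R f = epsilon (inhabits 0) P.
  by rewrite /discK Ez.
have exP : exists d, P d.
  by exists (ev_det z1 z2 z3 g h ^+ 2), (fun i => basis3 i); split;
    [exact: min_pair_integral_basis|rewrite embmx_basis3].
have [w [bw ->]] : P (discK R f) by rewrite EP; apply: epsilon_spec.
have [n En] := integral_basis_det bw min_pair_integral_basis.
have [m Em] := integral_basis_det min_pair_integral_basis bw.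
move: En Em; rewrite embmx_basis3 => En Em.
have [_ _ nz _] := mp.
have mn : m * n = 1.
  apply/eqP; rewrite -(eqr_int R[i]) intrM; apply/eqP.
  by apply: (mulIf nz); rewrite mul1r -mulrA -En -Em.
have n2 : n ^+ 2 = 1.
  have /eqP := congr1 absz mn; rewrite abszM muln_eq1 => /andP[_ /eqP].
  by case: (n) => [k /= ->|[|k]].
by rewrite En exprMn -rmorphXn /= n2 mul1r.
Qed.

End MinPair.
End Discriminant.

(** * Index forms *)

Section CubicForm.
Variable A : fieldType.
Variables (x1 x2 x3 y1 y2 y3 a0 a1 a b0 b1 b2 c0 c1 c2 : A).
Hypotheses (X1 : x1 * x1 = a0 + a1 * x1 + a * y1)
  (X2 : x2 * x2 = a0 + a1 * x2 + a * y2) (X3 : x3 * x3 = a0 + a1 * x3 + a * y3).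
Hypotheses (M1 : x1 * y1 = b0 + b1 * x1 + b2 * y1)
  (M2 : x2 * y2 = b0 + b1 * x2 + b2 * y2) (M3 : x3 * y3 = b0 + b1 * x3 + b2 * y3).
Hypotheses (Y1 : y1 * y1 = c0 + c1 * x1 + c2 * y1)
  (Y2 : y2 * y2 = c0 + c1 * x2 + c2 * y2) (Y3 : y3 * y3 = c0 + c1 * x3 + c2 * y3).
Let V := det3 x1 x2 x3 y1 y2 y3.

(** This and the next three lemmas show that the index form divided by [V] has coefficients in the
    multiplication table of [1, x, y]: its coefficients are determinants of products, and the table
    reduces those to multiples of [V]. *)
Lemma form_coef0 : (x2 - x1) * (x3 - x1) * (x3 - x2) = a * V.
Proof. by rewrite -[LHS]vandE X1 X2 X3 /V /det3; ring. Qed.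

Lemma form_coef1 :
  (x2 - x1) * (x3 - x1) * (y3 - y2) + (x2 - x1) * (y3 - y1) * (x3 - x2)
  + (y2 - y1) * (x3 - x1) * (x3 - x2) = (2 * b2 - a1) * V.
Proof.
(* The linear term in [u] of the determinant of [x + u y] and its square. *)
transitivity (2 * det3 x1 x2 x3 (x1 * y1) (x2 * y2) (x3 * y3)
  + det3 y1 y2 y3 (x1 * x1) (x2 * x2) (x3 * x3)); first by rewrite /det3; ring.
by rewrite X1 X2 X3 M1 M2 M3 /V /det3; ring.
Qed.

Lemma form_coef2 :
  (x2 - x1) * (y3 - y1) * (y3 - y2) + (y2 - y1) * (x3 - x1) * (y3 - y2)
  + (y2 - y1) * (y3 - y1) * (x3 - x2) = (c2 - 2 * b1) * V.
Proof.
transitivity (det3 x1 x2 x3 (y1 * y1) (y2 * y2) (y3 * y3)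
  + 2 * det3 y1 y2 y3 (x1 * y1) (x2 * y2) (x3 * y3)); first by rewrite /det3; ring.
by rewrite Y1 Y2 Y3 M1 M2 M3 /V /det3; ring.
Qed.

Lemma form_coef3 : (y2 - y1) * (y3 - y1) * (y3 - y2) = - c1 * V.
Proof. by rewrite -[LHS]vandE Y1 Y2 Y3 /V /det3; ring. Qed.

(** [a1 + b2] is the trace of multiplication by [x] in the basis [1, x, y]. Multiplying the rows of
    [V] by [x] one at a time gives trace times [V]; the row of ones contributes a repeated row,
    hence zero. *)
Lemma form_trace : V != 0 -> x1 + x2 + x3 = a1 + b2.
Proof.
move=> V0; apply: (mulIf V0).
transitivity (det3 x1 x2 x3 (x1 * y1) (x2 * y2) (x3 * y3)
  - det3 y1 y2 y3 (x1 * x1) (x2 * x2) (x3 * x3)); first by rewrite /V /det3; ring.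
by rewrite X1 X2 X3 M1 M2 M3 /V /det3; ring.
Qed.

(** This puts the ratio [(y3 - y2) / (x3 - x2)] in the field generated by [x1]: the trace turns
    [x2 + x3] into an expression in [x1]. *)
Lemma form_ratio : V != 0 -> (x3 - x2) * (b2 - x1) = a * (y3 - y2).
Proof.
move=> V0; have -> : b2 - x1 = x2 + x3 - a1.
  by rewrite -(addKr a1 b2) -form_trace //; ring.
transitivity (x3 * x3 - x2 * x2 - a1 * (x3 - x2)); first by ring.
by rewrite X2 X3; ring.
Qed.

End CubicForm.

(** Differences of vertices of a triangle are zero or signed sides, and any two different sides span
    the same area up to sign. *)
Lemma cross_det3 (A : comPzRingType) (x1 x2 x3 y1 y2 y3 : A) (P Q S T : A * A) :
  P \in [:: (x1, y1); (x2, y2); (x3, y3)] -> Q \in [:: (x1, y1); (x2, y2); (x3, y3)] ->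
  S \in [:: (x1, y1); (x2, y2); (x3, y3)] -> T \in [:: (x1, y1); (x2, y2); (x3, y3)] ->
  exists2 e : int, (absz e <= 1)%N & (P.1 - Q.1) * (S.2 - T.2) - (P.2 - Q.2) * (S.1 - T.1)
     = e%:~R * det3 x1 x2 x3 y1 y2 y3.
Proof.
rewrite !inE /det3.
by do 4!(case/or3P => /eqP ->) => /=;
  first [exists 0 => //; ring | exists 1 => //; ring | exists (-1) => //; ring].
Qed.

(** * Absolute values and diameters of sets of conjugates *)

Section ComplexAbs.
Variable R : realType.
Implicit Types x y : R[i].

Lemma cabsE x : `|x| = real_complex R (cabs x).
Proof. by rewrite /cabs normc_def. Qed.

Lemma cabsM x y : cabs (x * y) = cabs x * cabs y.
Proof. by apply: (@complexI R); rewrite rmorphM /= -!cabsE normrM. Qed.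

Lemma cabsD x y : cabs (x + y) <= cabs x + cabs y.
Proof. by rewrite -lecR rmorphD /= -!cabsE ler_normD. Qed.

Lemma cabsN x : cabs (- x) = cabs x.
Proof. by rewrite /cabs normrN. Qed.

Lemma cabsB x y : cabs (x - y) <= cabs x + cabs y.
Proof. by rewrite -(cabsN y) cabsD. Qed.

Lemma cabs_ge0 x : 0 <= cabs x.
Proof. by rewrite -lecR -cabsE normr_ge0. Qed.

Lemma cabs_eq0 x : (cabs x == 0) = (x == 0).
Proof. by rewrite -(inj_eq (@complexI R)) -cabsE normr_eq0. Qed.

Lemma cabs_gt0 x : (0 < cabs x) = (x != 0).
Proof. by rewrite lt_def cabs_ge0 andbT cabs_eq0. Qed.

Lemma cabs_int (n : int) : cabs (n%:~R : R[i]) = `|n|%:~R.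
Proof. by apply: (@complexI R); rewrite -cabsE rmorph_int -intr_norm. Qed.

Lemma cabs_conj x : cabs (conjc x) = cabs x.
Proof. by rewrite /cabs normcJ. Qed.

Lemma cabs_le_ReIm x : cabs x <= `|complex.Re x| + `|complex.Im x|.
Proof.
rewrite {1}[x]complexE (le_trans (cabsD _ _)) // cabsM.
have cabsr (r : R) : cabs (real_complex R r) = `|r|.
  by rewrite /cabs normc_def /= expr0n addr0 sqrtr_sqr.
have -> : cabs (Complex 0 1 : R[i]) = 1 by rewrite /cabs normc_def /= expr0n add0r expr1n sqrtr1.
by rewrite mul1r !cabsr.
Qed.

Lemma Im_le_cabs x : `|complex.Im x| *+ 2 <= cabs (x - conjc x).
Proof.
case: x => a b; rewrite /cabs normc_def /= subrr expr0n add0r opprK sqrtr_sqr.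
by rewrite -mulr2n normrMn.
Qed.

End ComplexAbs.

Lemma cross_ratio (A : fieldType) (d d' e e' : A) : d != 0 -> d' != 0 ->
  d * e' - e * d' = (e' / d' - e / d) * (d * d').
Proof. by move=> d0 d'0; field; rewrite d0 d'0. Qed.

Section Diameter.
Variable R : realType.
Variables (f : {poly rat}) (z1 z2 z3 : R[i]).
Hypotheses (cf : cubic f) (H : roots3 f z1 z2 z3).
Implicit Types (g h : {poly rat}) (x y u v : R[i]).

Lemma mem_roots x : (x \in [:: z1; z2; z3]) = (ev x f == 0).
Proof.
have l0 : ratr f`_3 != 0 :> R[i] by rewrite fmorph_eq0 cubic_coef3.
rewrite H mulf_eq0 (negPf l0) /= !mulf_eq0 !subr_eq0.
by rewrite !inE orbA.
Qed.

Lemma conj_mem_roots x : x \in [:: z1; z2; z3] -> conjc x \in [:: z1; z2; z3].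
Proof. by rewrite !mem_roots -conjc_ev => /eqP ->; rewrite conjc0. Qed.

Definition ev_diam g : R :=
  Num.max (cabs (ev z2 g - ev z1 g))
    (Num.max (cabs (ev z3 g - ev z1 g)) (cabs (ev z3 g - ev z2 g))).

Lemma diam_ge0 g : 0 <= ev_diam g.
Proof. by rewrite !le_max cabs_ge0. Qed.

Lemma cabs_distC x y : cabs (x - y) = cabs (y - x).
Proof. by rewrite -cabsN opprB. Qed.

Lemma diam_ge g x y : x \in [:: z1; z2; z3] -> y \in [:: z1; z2; z3] ->
  cabs (ev x g - ev y g) <= ev_diam g.
Proof.
have c0 u : cabs (ev u g - ev u g) <= ev_diam g.
  rewrite subrr; have /eqP -> : cabs (0 : R[i]) == 0 by rewrite cabs_eq0.
  exact: diam_ge0.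
rewrite !inE => /or3P[]/eqP-> /or3P[]/eqP->; rewrite ?c0 // /ev_diam !le_max;
  by rewrite ?lexx ?orbT // cabs_distC lexx ?orbT.
Qed.

Lemma diam_attained g : exists x y, [/\ x \in [:: z1; z2; z3],
  y \in [:: z1; z2; z3] & ev_diam g = cabs (ev x g - ev y g)].
Proof.
rewrite /ev_diam /Num.max; case: ifP => _; first case: ifP => _.
- by exists z3, z2; rewrite !inE !eqxx !orbT.
- by exists z3, z1; rewrite !inE !eqxx !orbT.
- by exists z2, z1; rewrite !inE !eqxx !orbT.
Qed.

Lemma diam_gt0 g : (size g <= 3)%N -> nonconst g -> 0 < ev_diam g.
Proof.
move=> sg ng; have [n1 _ _] := ev_neq3 cf H sg ng.
by rewrite /ev_diam lt_max cabs_gt0 subr_eq0 eq_sym n1.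
Qed.

Let d3 := ev_det z1 z2 z3.

Lemma cross_le g h x y u v : x \in [:: z1; z2; z3] -> y \in [:: z1; z2; z3] ->
  u \in [:: z1; z2; z3] -> v \in [:: z1; z2; z3] ->
  cabs ((ev x g - ev y g) * (ev u h - ev v h)
     - (ev x h - ev y h) * (ev u g - ev v g)) <= cabs (d3 g h).
Proof.
have M w : w \in [:: z1; z2; z3] ->
    (ev w g, ev w h) \in [:: (ev z1 g, ev z1 h); (ev z2 g, ev z2 h); (ev z3 g, ev z3 h)].
  by rewrite !inE => /or3P[]/eqP->; rewrite eqxx ?orbT.
move=> /M mx /M my /M mu /M mv.
have [e e1 /= ->] := cross_det3 mx my mu mv.
rewrite cabsM cabs_int ler_piMl ?cabs_ge0 //.
by rewrite -abszE -[leRHS]/(1%:R) ler_nat.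
Qed.

(* Shifting by the floor of the real part of the ratio eps/delta of the longest
   pair of conjugates is enough: conjugation permutes the roots, so the
   imaginary part of the ratio is controlled by the determinant. *)
Lemma reduce_diam g h : 0 < ev_diam g ->
  exists n : int, ev_diam (h - n%:~R *: g) <= ev_diam g + 2 * cabs (d3 g h) / ev_diam g.
Proof.
move=> T0; have [x [y [mx my ET]]] := diam_attained g.
set T := ev_diam g in T0 ET *; set W := cabs (d3 g h).
set dl := ev x g - ev y g in ET; pose ep := ev x h - ev y h.
have dl0 : dl != 0 by rewrite -cabs_gt0 -ET.
pose rho := ep / dl; pose n := Num.floor (complex.Re rho); exists n.
have W0 : 0 <= W by exact: cabs_ge0.
have evn w : ev w (h - n%:~R *: g) = ev w h - n%:~R * ev w g.
  by rewrite evB evZ ratr_int.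
have imb : `|complex.Im rho| <= W / T ^+ 2.
  have T20 : 0 < T ^+ 2 by rewrite exprn_gt0.
  rewrite ler_pdivlMr //.
  have : cabs (dl * conjc ep - ep * conjc dl) <= W.
    by rewrite !rmorphB /= !conjc_ev; apply: cross_le => //; apply: conj_mem_roots.
  have -> : dl * conjc ep - ep * conjc dl = (conjc rho - rho) * (dl * conjc dl).
    by rewrite /rho fmorph_div; apply: cross_ratio => //; rewrite conjc_eq0.
  rewrite cabsM cabs_distC cabsM cabs_conj -ET -expr2.
  apply: le_trans; rewrite ler_pM2r // (le_trans _ (Im_le_cabs _)) //.
  by rewrite mulr2n lerDl normr_ge0.
have epb : cabs (ep - n%:~R * dl) <= T + W / T.
  have -> : ep - n%:~R * dl = (rho - n%:~R) * dl by rewrite mulrBl divfK.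
  rewrite cabsM -ET.
  have -> : T + W / T = (1 + W / T ^+ 2) * T by field; rewrite gt_eqF.
  rewrite ler_pM2r //; apply: le_trans (cabs_le_ReIm _) _.
  have fl : `|complex.Re rho - n%:~R| <= 1.
    have := floor_itv (complex.Re rho); rewrite -/n intrD => /andP[l u].
    by rewrite ger0_norm ?subr_ge0 // lerBlDl ltW.
  have -> : n%:~R = real_complex R n%:~R by rewrite rmorph_int.
  by case: (rho) fl imb => r1 r2 /= fl imb; rewrite subr0 lerD.
have [u [v [mu mv ->]]] := diam_attained (h - n%:~R *: g).
rewrite -(ler_pM2r T0) [leRHS](_ : _ = W + (T + W / T) * T); last first.
  by field; rewrite gt_eqF.
rewrite !evn {1}ET -cabsM.
(* Multiplying by [dl], of modulus [T], trades an arbitrary difference of conjugates of [h] for the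
   longest pair of [g]: a cross determinant of modulus at most [W] remains, plus a term that [epb]
   bounds. *)
set E := (X in cabs X).
have -> : E = (dl * (ev u h - ev v h) - ep * (ev u g - ev v g))
    + (ep - n%:~R * dl) * (ev u g - ev v g) by rewrite /E; ring.
apply: le_trans (cabsD _ _) _; apply: lerD; first exact: cross_le.
by rewrite cabsM ler_pM ?cabs_ge0 // diam_ge.
Qed.

End Diameter.

Section IntegerBox.
Variable R : realType.

Definition irange (B : R) : seq int :=
  [seq i%:Z - (Num.truncn B)%:Z | i <- iota 0 (Num.truncn B).*2.+1].

Lemma size_irange (B : R) : 0 <= B -> (size (irange B))%:R <= 2 * B + 1.
Proof.
move=> B0; rewrite size_map size_iota -addn1 natrD -muln2 natrM mulrC.
by rewrite lerD2r ler_pM2l // truncn_le.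
Qed.

Lemma mem_irange (B : R) (x : int) : `|x|%:~R <= B -> x \in irange B.
Proof.
move=> xB; have B0 : 0 <= B by rewrite (le_trans _ xB) // ler0z.
have xN : (absz x <= Num.truncn B)%N.
  by rewrite truncn_ge_nat // (le_trans _ xB) // -abszE.
apply/mapP; exists (absz (x + (Num.truncn B)%:Z)); rewrite ?mem_iota; lia.
Qed.

End IntegerBox.

(** * Forms as products of linear factors, and their shifts *)

Section FormAlgebra.
Variable A : fieldType.
Variables (p q r p' q' r' V a b c d : A).
Hypotheses (E0 : p * q * r = a * V)
  (E1 : p * q * r' + p * q' * r + p' * q * r = b * V)
  (E2 : p * q' * r' + p' * q * r' + p' * q' * r = c * V)
  (E3 : p' * q' * r' = d * V).

(** Up to [V] the cubic is [(p x - p') (q x - q') (r x - r')], and [x] kills the last factor. *)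
Lemma form_root x : V != 0 -> r * x = r' -> a * x ^+ 3 - b * x ^+ 2 + c * x - d = 0.
Proof.
move=> V0 rx; apply: (mulIf V0); rewrite mul0r.
transitivity (a * V * x ^+ 3 - b * V * x ^+ 2 + c * V * x - d * V); first by ring.
rewrite -E0 -E1 -E2 -E3.
transitivity ((p * x - p') * (q * x - q') * (r * x - r')); first by ring.
by rewrite rx subrr mulr0.
Qed.

Lemma form_shift1 k : p * q * (r' + k * r) + p * (q' + k * q) * r
  + (p' + k * p) * q * r = (b + 3 * a * k) * V.
Proof.
transitivity (p * q * r' + p * q' * r + p' * q * r + 3 * k * (p * q * r)); first by ring.
by rewrite E1 E0; ring.
Qed.

Lemma form_shift2 k : p * (q' + k * q) * (r' + k * r)
  + (p' + k * p) * q * (r' + k * r)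
  + (p' + k * p) * (q' + k * q) * r = (c + 2 * b * k + 3 * a * k ^+ 2) * V.
Proof.
transitivity (p * q' * r' + p' * q * r' + p' * q' * r +
  2 * k * (p * q * r' + p * q' * r + p' * q * r)
  + 3 * k ^+ 2 * (p * q * r)); first by ring.
by rewrite E2 E1 E0; ring.
Qed.

Lemma form_shift3 k : (p' + k * p) * (q' + k * q) * (r' + k * r)
  = (d + c * k + b * k ^+ 2 + a * k ^+ 3) * V.
Proof.
transitivity (p' * q' * r' + k * (p * q' * r' + p' * q * r' + p' * q' * r) +
  k ^+ 2 * (p * q * r' + p * q' * r + p' * q * r)
  + k ^+ 3 * (p * q * r)); first by ring.
by rewrite E3 E2 E1 E0; ring.
Qed.

End FormAlgebra.

(* The form evaluated at (X, -1); its roots are the ratios of conjugate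
   differences of the two basis elements. *)
Definition form_poly (a b c d : int) : {poly rat} :=
  a%:~R *: 'X^3 - b%:~R *: 'X^2 + c%:~R *: 'X - (d%:~R)%:P.

Lemma size_form_poly a b c d : a != 0 -> size (form_poly a b c d) = 4%N.
Proof.
move=> a0; rewrite /form_poly -!addrA size_polyDl.
  by rewrite size_scale ?size_polyXn ?intr_eq0.
rewrite size_scale ?intr_eq0 // size_polyXn ltnS.
rewrite (leq_trans (size_polyD _ _)) // geq_max size_polyN.
rewrite (leq_trans (size_scale_leq _ _)) ?size_polyXn //=.
rewrite (leq_trans (size_polyD _ _)) // geq_max size_polyN.
rewrite (leq_trans (size_scale_leq _ _)) ?size_polyX //=.
by rewrite (leq_trans (size_polyC_leq1 _)).
Qed.

Lemma ev_form_poly (C : numFieldType) (x : C) a b c d : ev x (form_poly a b c d) =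
  a%:~R * x ^+ 3 - b%:~R * x ^+ 2 + c%:~R * x - d%:~R.
Proof.
have Xn n : ev x 'X^n = x ^+ n by rewrite /ev map_polyXn hornerXn.
by rewrite /form_poly !(evB, evD) !evZ !Xn evX evC !ratr_int.
Qed.

(** A form remembers a field through one primitive element that is a zero of its cubic; [a != 0]
    keeps the degree equal to 3. *)
Definition represents (R : realType) (f : {poly rat}) (F : int * int * int * int) :=
  let: (a, b, c, d) := F in
  a != 0 /\ exists (z1 z2 z3 : R[i]) (g : {poly rat}), [/\ roots3 f z1 z2 z3, (size g <= 3)%N,
    nonconst g & ev (ev z1 g) (form_poly a b c d) = 0].

Lemma represents_iso (R : realType) f1 f2 F : cubic f1 -> cubic f2 ->
  represents R f1 F -> represents R f2 F -> iso_fields f1 f2.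
Proof.
case: F => [[[a b] c] d] cf1 cf2 [a0 [z1 [z2 [z3 [g1 [H1 s1 n1 e1]]]]]].
move=> [_ [y1 [y2 [y3 [g2 [H2 s2 n2 e2]]]]]].
exact: iso_of_common_root H1 H2 s1 n1 s2 n2 (size_form_poly b c d a0) e1 e2.
Qed.

(* The form of the basis 1, g, h + k g when F is the form of 1, g, h. *)
Definition shift_form (F : int * int * int * int) (k : int) : int * int * int * int :=
  let: (a, b, c, d) := F in
  (a, b + 3 * a * k, c + 2 * b * k + 3 * a * k ^+ 2,
   d + c * k + b * k ^+ 2 + a * k ^+ 3).

Section FormFamily.
Variable R : realType.
Variables (f : {poly rat}) (z1 z2 z3 : R[i]).
Hypotheses (cf : cubic f) (H : roots3 f z1 z2 z3).
Implicit Types (g h k : {poly rat}).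
Let d3 := ev_det z1 z2 z3.
Let diam := ev_diam z1 z2 z3.
Let e1 : ev z1 f = 0 := roots3_1 H.
Let e2 : ev z2 f = 0 := roots3_1 (roots3_rot H).
Let e3 : ev z3 f = 0 := roots3_1 (roots3_rot (roots3_rot H)).

Lemma nonconst_d3l g h : (size g <= 3)%N -> (size h <= 3)%N -> d3 g h != 0 -> nonconst g.
Proof.
move=> sg sh; rewrite /nonconst; apply: contraR; rewrite negb_or !negbK.
move=> /andP[/eqP g1 /eqP g2].
by rewrite /d3 /ev_det det3_ev // g1 g2 mul0r mulr0 subrr rmorph0 mul0r.
Qed.

Lemma nonconst_d3r g h : (size g <= 3)%N -> (size h <= 3)%N -> d3 g h != 0 -> nonconst h.
Proof.
move=> sg sh; rewrite /nonconst; apply: contraR; rewrite negb_or !negbK.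
move=> /andP[/eqP g1 /eqP g2].
by rewrite /d3 /ev_det det3_ev // g1 g2 mul0r mulr0 subrr rmorph0 mul0r.
Qed.

Lemma size_comb (n : rat) g h : (size g <= 3)%N -> (size h <= 3)%N ->
  (size (h + n *: g)%R <= 3)%N.
Proof.
move=> sg sh; rewrite (leq_trans (size_polyD _ _)) // geq_max sh.
by rewrite (leq_trans (size_scale_leq _ _)).
Qed.

Lemma ev_det_shift (n : rat) g h : d3 g (h + n *: g) = d3 g h.
Proof. by rewrite /d3 /ev_det !evD !evZ /det3; ring. Qed.

Lemma min_pair_structure g h k : min_pair f z1 z2 z3 g h -> in_OK f k ->
  exists r s t : int, forall z : R[i], ev z f = 0 ->
    ev z k = r%:~R + s%:~R * ev z g + t%:~R * ev z h.
Proof.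
move=> mp Ok; have f0 : f != 0 by rewrite -size_poly_eq0; case: cf => ->.
have sm : (size (k %% f)%R <= 3)%N by rewrite -ltnS -(proj1 cf) ltn_modp.
have [r [s [t E]]] := min_pair_basis cf H mp (conj sm (in_OK_modp cf H Ok)).
exists r, s, t => z z0.
by rewrite -(ev_modp _ z0) E !evD !evZ evC !ratr_int.
Qed.

(** Since [1, g, h] is an integral basis, the products [g^2], [g h], [h^2] have integer coordinates,
    which supply the form; [e] is the coordinate of [g h] on [h]. *)
Lemma min_pair_form g h : min_pair f z1 z2 z3 g h ->
  exists (F : int * int * int * int) (e : int), let: (a, b, c, d) := F in
  let: (p, q, r) := (ev z2 g - ev z1 g, ev z3 g - ev z1 g, ev z3 g - ev z2 g) in
  let: (p', q', r') := (ev z2 h - ev z1 h, ev z3 h - ev z1 h, ev z3 h - ev z2 h) in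
  [/\ p * q * r = a%:~R * d3 g h,
      p * q * r' + p * q' * r + p' * q * r = b%:~R * d3 g h,
      p * q' * r' + p' * q * r' + p' * q' * r = c%:~R * d3 g h,
      p' * q' * r' = d%:~R * d3 g h
    & r * (e%:~R - ev z1 g) = a%:~R * r'].
Proof.
move=> mp; have [[sg Og] [sh Oh] nz _] := mp.
have [a0 [a1 [a EX]]] := min_pair_structure mp (in_OK_mul cf H Og Og).
have [b0 [b1 [b2 EM]]] := min_pair_structure mp (in_OK_mul cf H Og Oh).
have [c0 [c1 [c2 EY]]] := min_pair_structure mp (in_OK_mul cf H Oh Oh).
have X z z0 := esym (etrans (esym (EX z z0)) (evM z g g)).
have M z z0 := esym (etrans (esym (EM z z0)) (evM z g h)).
have Y z z0 := esym (etrans (esym (EY z z0)) (evM z h h)).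
exists (a, 2 * b2 - a1, c2 - 2 * b1, - c1), b2; split.
- exact: form_coef0 (X _ e1) (X _ e2) (X _ e3).
- by rewrite rmorphB rmorphM; apply: form_coef1 (X _ e1) (X _ e2) (X _ e3)
    (M _ e1) (M _ e2) (M _ e3).
- by rewrite rmorphB rmorphM; apply: form_coef2 (M _ e1) (M _ e2) (M _ e3)
    (Y _ e1) (Y _ e2) (Y _ e3).
- by rewrite rmorphN; apply: form_coef3 (Y _ e1) (Y _ e2) (Y _ e3).
- exact: form_ratio (X _ e1) (X _ e2) (X _ e3) (M _ e1) (M _ e2) (M _ e3) nz.
Qed.

Lemma diam_shift (n : int) g h : diam (h + n%:~R *: g) <= diam h + `|n|%:~R * diam g.
Proof.
have [x [y [mx my E]]] := diam_attained z1 z2 z3 (h + n%:~R *: g).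
rewrite /diam E !evD !evZ ratr_int.
have -> : ev x h + n%:~R * ev x g - (ev y h + n%:~R * ev y g) =
  (ev x h - ev y h) + n%:~R * (ev x g - ev y g) by ring.
apply: le_trans (cabsD _ _) _; rewrite cabsM cabs_int lerD ?diam_ge //.
by rewrite ler_wpM2l ?ler0z // diam_ge.
Qed.

Lemma diam_bounds g : [/\ cabs (ev z2 g - ev z1 g) <= diam g,
  cabs (ev z3 g - ev z1 g) <= diam g & cabs (ev z3 g - ev z2 g) <= diam g].
Proof. by rewrite /diam /ev_diam !le_max !lexx !orbT. Qed.

Lemma cabs3_le (x y z : R[i]) (X Y Z : R) : cabs x <= X -> cabs y <= Y -> cabs z <= Z ->
  cabs (x * y * z) <= X * Y * Z.
Proof. by move=> xX yY zZ; rewrite !cabsM !ler_pM ?mulr_ge0 ?cabs_ge0. Qed.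

(** Under the condition on [k], differences of conjugates of [h + k g] are at most
    [(M + 4) (s / T)], whence [N]. Each coefficient times the determinant is a sum of products of
    three differences, with at most three summands. *)
Lemma form_family g h (M : R) : min_pair f z1 z2 z3 g h -> 1 <= cabs (d3 g h) ->
  0 <= M -> diam h <= M * (cabs (d3 g h) / diam g) ->
  let T := diam g in let s := cabs (d3 g h) in let N := M + 4 in
  exists F : int * int * int * int, forall k : nat, k%:R * T <= 4 * (s / T) ->
  let: (a, b, c, d) := shift_form F k%:Z in
  [/\ represents R f (shift_form F k%:Z), d != 0 &
  [/\ `|a|%:~R <= T ^+ 3 / s, `|b|%:~R <= 3 * N * T,
      `|c|%:~R <= 3 * N ^+ 2 * (s / T) & `|d|%:~R <= N ^+ 3 * (s ^+ 2 / T ^+ 3)]].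
Proof.
move=> mp s1 M0 hM T s N; have [[[[a b] c] d] [e]] := min_pair_form mp.
have [[sg Og] [sh Oh] nz _] := mp.
have ng := nonconst_d3l sg sh nz.
have [n1 n2 n3] := ev_neq3 cf H sg ng.
set p := ev z2 g - ev z1 g; set q := ev z3 g - ev z1 g; set r := ev z3 g - ev z2 g.
set p' := ev z2 h - ev z1 h; set q' := ev z3 h - ev z1 h; set r' := ev z3 h - ev z2 h.
move=> [E0 E1 E2 E3 Er]; exists (a, b, c, d) => k kT.
have T0 : 0 < T by exact: (diam_gt0 cf H sg ng).
have s0 : 0 < s by rewrite (lt_le_trans ltr01).
have nV : d3 g h != 0 by [].
have r0 : r != 0 by rewrite subr_eq0 eq_sym.
have a0 : a != 0.
  have : p * q * r != 0 by exact: (vand_neq0 n1 n2 n3).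
  by rewrite E0 mulf_eq0 intr_eq0; case: eqP.
pose hk := h + (k%:Z)%:~R *: g.
have shk : (size hk <= 3)%N by exact: size_comb.
have nhk : nonconst hk by apply: (nonconst_d3r sg shk); rewrite ev_det_shift.
have [m1 m2 m3] := ev_neq3 cf H shk nhk.
have evk z : ev z hk = ev z h + k%:R * ev z g by rewrite evD evZ ratr_int.
have Ep : p' + k%:R * p = ev z2 hk - ev z1 hk by rewrite !evk /p' /p; ring.
have Eq : q' + k%:R * q = ev z3 hk - ev z1 hk by rewrite !evk /q' /q; ring.
have Err : r' + k%:R * r = ev z3 hk - ev z2 hk by rewrite !evk /r' /r; ring.
have F1 := form_shift1 E0 E1 k%:R.
have F2 := form_shift2 E0 E1 E2 k%:R.
have F3 := form_shift3 E0 E1 E2 E3 k%:R.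
set b_ := b + 3 * a * k%:Z; set c_ := c + 2 * b * k%:Z + 3 * a * k%:Z ^+ 2.
set d_ := d + c * k%:Z + b * k%:Z ^+ 2 + a * k%:Z ^+ 3.
have Eb : b%:~R + 3 * a%:~R * k%:R = b_%:~R :> R[i].
  by rewrite /b_ rmorphD !rmorphM.
have Ec : c%:~R + 2 * b%:~R * k%:R + 3 * a%:~R * k%:R ^+ 2 = c_%:~R :> R[i].
  by rewrite /c_ !rmorphD !rmorphM /=; ring.
have Ed : d%:~R + c%:~R * k%:R + b%:~R * k%:R ^+ 2 + a%:~R * k%:R ^+ 3 = d_%:~R :> R[i].
  by rewrite /d_ !rmorphD !rmorphM /=; ring.
rewrite {}Eb in F1; rewrite {}Ec in F2; rewrite {}Ed in F3.
have [pT qT rT] : [/\ cabs p <= T, cabs q <= T & cabs r <= T] by exact: diam_bounds.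
have hkT : diam hk <= N * (s / T).
  apply: le_trans (diam_shift k%:Z g h) _; rewrite /N mulrDl lerD //.
have [pN qN rN] := diam_bounds hk.
rewrite -Ep in pN; rewrite -Eq in qN; rewrite -Err in rN.
have {}pN := le_trans pN hkT; have {}qN := le_trans qN hkT.
have {}rN := le_trans rN hkT.
have bound (n : int) (B : R) (x : R[i]) : x = n%:~R * d3 g h -> cabs x <= B * s ->
    `|n|%:~R <= B.
  by move=> -> ; rewrite cabsM cabs_int ler_pM2r.
rewrite /=; split.
(* The witness [(e - g) / a + k] is, at [z1], the ratio of the differences of [h + k g] and [g]. *)
- split=> //; exists z1, z2, z3, (a%:~R^-1 *: (e%:~R%:P - g) + (k%:~R)%:P); split=> //.
  + rewrite (leq_trans (size_polyD _ _)) // geq_max.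
    rewrite (leq_trans (size_scale_leq _ _)) /=; last first.
      rewrite (leq_trans (size_polyD _ _)) // geq_max size_polyN sg andbT.
      by rewrite (leq_trans (size_polyC_leq1 _)).
    by rewrite (leq_trans (size_polyC_leq1 _)).
  + have q0 : a%:~R^-1 != 0 :> rat by rewrite invr_eq0 intr_eq0.
    rewrite /nonconst !coefD !coefZ !coefD !coefN !coefC /= !addr0 !sub0r.
    by rewrite !mulf_eq0 !oppr_eq0 (negPf q0) /=; exact: ng.
  + rewrite ev_form_poly evD evZ evB !evC.
    have -> : ratr (a%:~R^-1) = a%:~R^-1 :> R[i] by rewrite fmorphV /= ratr_int.
    rewrite !ratr_int.
    apply: (form_root E0 F1 F2 F3 nV).
    rewrite mulrDr mulrCA Er mulKf ?intr_eq0 //.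
    by rewrite [r * _]mulrC.
- have : (ev z2 hk - ev z1 hk) * (ev z3 hk - ev z1 hk) * (ev z3 hk - ev z2 hk) != 0.
    exact: (vand_neq0 m1 m2 m3).
  by rewrite -Ep -Eq -Err F3 mulf_eq0 intr_eq0 => /norP[].
split.
- apply: (bound _ _ _ E0); rewrite divfK ?gt_eqF //.
  by rewrite [leRHS](_ : _ = T * T * T) ?cabs3_le // !exprS expr0 mulr1 mulrA.
- apply: (bound _ _ _ F1).
  apply: le_trans (cabsD _ _) _; apply: le_trans (lerD (cabsD _ _) (lexx _)) _.
  apply: le_trans (lerD (lerD (cabs3_le pT qT rN) (cabs3_le pT qN rT)) (cabs3_le pN qT rT)) _.
  by rewrite le_eqVlt; apply/orP; left; apply/eqP; field; rewrite gt_eqF.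
- apply: (bound _ _ _ F2).
  apply: le_trans (cabsD _ _) _; apply: le_trans (lerD (cabsD _ _) (lexx _)) _.
  apply: le_trans (lerD (lerD (cabs3_le pT qN rN) (cabs3_le pN qT rN)) (cabs3_le pN qN rT)) _.
  by rewrite le_eqVlt; apply/orP; left; apply/eqP; field; rewrite gt_eqF.
- apply: (bound _ _ _ F3).
  apply: le_trans (cabs3_le pN qN rN) _.
  by rewrite le_eqVlt; apply/orP; left; apply/eqP; field; rewrite gt_eqF.
Qed.

End FormFamily.

(** * Reduced elements of one field *)

Lemma small_mul3 (t t' u : int) : (absz t <= 1)%N -> (absz t' <= 1)%N ->
  t - t' = u *+ 3 -> u = 0.
Proof. lia. Qed.

Section CountReduced.
Variable R : realType.
Variables (f : {poly rat}) (z1 z2 z3 : R[i]).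
Hypotheses (cf : cubic f) (H : roots3 f z1 z2 z3).
Hypothesis Ez : conj_roots R f = [:: z1; z2; z3].
Implicit Types (g h k : {poly rat}).
Let d3 := ev_det z1 z2 z3.
Let diam := ev_diam z1 z2 z3.

Lemma in_S_cabs (Y : R) k z : in_S f Y k -> z \in [:: z1; z2; z3] -> cabs (ev z k) < Y.
Proof.
move=> [_ _ _ _]; rewrite /abs_inf /embeds Ez /= -!/(ev _ _) !gt_max.
by move=> /and4P[c1 c2 c3 _]; rewrite !inE => /or3P[]/eqP->.
Qed.

Lemma in_S_diam (Y : R) k : in_S f Y k -> diam k <= 2 * Y.
Proof.
move=> Sk; have [x [y [mx my E]]] := diam_attained z1 z2 z3 k.
rewrite /diam E mulr2n mulrDl mul1r (le_trans (cabsB _ _)) //.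
by rewrite lerD // ltW // in_S_cabs.
Qed.

Lemma in_S_trace (Y : R) k : in_S f Y k -> exists2 t : int, (absz t <= 1)%N &
  ev z1 k + ev z2 k + ev z3 k = t%:~R.
Proof.
move=> [_ _ _ + _]; rewrite /trK /embeds Ez /= !big_cons big_nil -!/(ev _ _) addr0 addrA.
by rewrite !inE => /or3P[]/eqP->; [exists (-1)|exists 0|exists 1].
Qed.

(* Coordinates with respect to [1, g, h]: the coefficient of [h] is read off a
   determinant, the one of [g] off the longest difference of conjugates of [g],
   and the coefficient of [1] is fixed by the trace. *)
Lemma count_in_S g h (M Y : R) (l : seq {poly rat}) : min_pair f z1 z2 z3 g h ->
  0 < cabs (d3 g h) -> 0 <= M -> diam h <= M * (cabs (d3 g h) / diam g) ->
  diam g <= 2 * Y -> uniq l -> (forall k, k \in l -> in_S f Y k) ->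
  (size l)%:R <= (48 + 64 * M) * (Y / diam g) * (Y * diam g / cabs (d3 g h) + 1).
Proof.
set T := diam g; set s := cabs (d3 g h) => mp s0 M0 hM TY ul lS.
have [[sg Og] [sh Oh] nz _] := mp.
have T0 : 0 < T by exact: (diam_gt0 cf H sg (nonconst_d3l sg sh nz)).
have Y0 : 0 <= Y by rewrite -(pmulr_rge0 _ (ltr0n R 2)) (le_trans _ TY) // ltW.
have /choice[c cP] k : exists xy : int * int, k \in l ->
    exists r : int, k = (r%:~R)%:P + xy.1%:~R *: g + xy.2%:~R *: h.
  have [kl|_] := boolP (k \in l); last by exists (0, 0).
  have [sk Ok _ _ _] := lS k kl.
  have [r [x [y E]]] := min_pair_basis cf H mp (conj sk Ok).
  by exists (x, y) => _; exists r.
(* [B2] comes from [|det(g, k)| <= 2 T (2 Y)]. Removing the [h]-part from a longest difference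
   leaves at most [2 Y + B2 M s / T = (2 + 4 M) Y], which over [T] is [B1]. *)
pose B2 : R := 4 * (Y * T / s); pose B1 : R := (2 + 4 * M) * (Y / T).
have YT0 : 0 <= Y / T by rewrite divr_ge0 // ltW.
have YTs0 : 0 <= Y * T / s by rewrite !divr_ge0 ?mulr_ge0 // ltW.
have B10 : 0 <= B1 by rewrite mulr_ge0 // addr_ge0 // mulr_ge0.
have B20 : 0 <= B2 by rewrite mulr_ge0.
have cB2 k : k \in l -> `|(c k).2|%:~R <= B2.
  move=> kl; have [r E] := cP k kl; have Sk := lS k kl.
  have dk : d3 g k = (c k).2%:~R * d3 g h.
    by rewrite [X in d3 g X]E /d3 ev_det_combr ratr_int.
  rewrite -(ler_pM2r s0) -cabs_int -cabsM -dk [leRHS](_ : _ = T * (2 * Y) + T * (2 * Y)).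
    have [p q _] := diam_bounds z1 z2 z3 g; have [p' q' _] := diam_bounds z1 z2 z3 k.
    have bd (u v : R[i]) : cabs u <= T -> cabs v <= diam k -> cabs (u * v) <= T * (2 * Y).
      move=> uT vk; rewrite cabsM.
      exact: ler_pM (cabs_ge0 u) (cabs_ge0 v) uT (le_trans vk (in_S_diam Sk)).
    exact: le_trans (cabsB _ _) (lerD (bd _ _ p q') (bd _ _ q p')).
  by rewrite /B2; field; rewrite gt_eqF.
have cB1 k : k \in l -> `|(c k).1|%:~R <= B1.
  move=> kl; have [r E] := cP k kl; have Sk := lS k kl.
  have [x [y [mx my ET]]] := diam_attained z1 z2 z3 g.
  rewrite -(ler_pM2r T0) [X in _ * X <= _]ET -cabs_int -cabsM.
  have -> : (c k).1%:~R * (ev x g - ev y g) =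
      (ev x k - ev y k) - (c k).2%:~R * (ev x h - ev y h).
    by rewrite [in ev x k]E [in ev y k]E !evD !evZ !evC !ratr_int; ring.
  apply: le_trans (cabsB _ _) _; rewrite cabsM cabs_int.
  rewrite [leRHS](_ : _ = 2 * Y + B2 * (M * (s / T))); last first.
    by rewrite /B1 /B2; field; rewrite !gt_eqF.
  apply: lerD; first by apply: le_trans (diam_ge _ mx my) (in_S_diam Sk).
  apply: ler_pM; rewrite ?cabs_ge0 ?ler0z ?cB2 //.
  exact: le_trans (diam_ge _ mx my) hM.
have cinj : {in l &, injective c}.
  move=> k k' kl kl' Ec; have [r E] := cP k kl; have [r' E'] := cP k' kl'.
  have [t t1 Et] := in_S_trace (lS k kl); have [t' t1' Et'] := in_S_trace (lS k' kl').
  have D z : ev z k - ev z k' = (r - r')%:~R :> R[i].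
    by rewrite {1}E E' Ec !evD !evC !ratr_int rmorphB; ring.
  (* Elements with equal coordinates differ by an integer, whose trace is three times itself, while
     traces in [{-1, 0, 1}] differ by at most 2. *)
  have : (t - t')%:~R = ((r - r') *+ 3)%:~R :> R[i].
    rewrite [RHS]rmorphMn -[in RHS]/((r - r')%:~R) [LHS]rmorphB -[LHS]/(t%:~R - t'%:~R) -Et -Et'.
    transitivity ((ev z1 k - ev z1 k') + (ev z2 k - ev z2 k') + (ev z3 k - ev z3 k')).
      by ring.
    by rewrite !D; ring.
  move/eqP; rewrite eqr_int => /eqP tt.
  have /eqP := small_mul3 t1 t1' tt; rewrite subr_eq0 => /eqP rr.
  by rewrite E E' Ec rr.
have sub : {subset map c l <= [seq (x, y) | x <- irange B1, y <- irange B2]}.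
  move=> _ /mapP[k kl ->]; rewrite [c k]surjective_pairing.
  by apply: allpairs_f; apply: mem_irange; [exact: cB1|exact: cB2].
have := uniq_leq_size (_ : uniq (map c l)) sub; rewrite map_inj_in_uniq // => /(_ ul).
rewrite size_map size_allpairs -(ler_nat R) natrM => /le_trans; apply.
apply: le_trans (ler_pM _ _ (size_irange B10) (size_irange B20)) _; rewrite ?ler0n //.
(* As [T <= 2 Y], the 1 in [2 B1 + 1] is absorbed, giving [(6 + 8 M) (Y / T)]; the other factor is
   at most [8 (Y T / s + 1)], and [8 (6 + 8 M) = 48 + 64 M]. *)
have YT1 : 1 <= 2 * (Y / T) by rewrite mulrA ler_pdivlMr // mul1r.
have -> : (48 + 64 * M) * (Y / T) * (Y * T / s + 1) =
  ((6 + 8 * M) * (Y / T)) * (8 * (Y * T / s) + 8) by ring.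
apply: ler_pM; [by rewrite addr_ge0 // mulr_ge0|by rewrite addr_ge0 // mulr_ge0| |].
  rewrite /B1 -subr_ge0 [leRHS](_ : _ = 2 * (Y / T) - 1); last by ring.
  by rewrite subr_ge0.
rewrite /B2 -subr_ge0 [leRHS](_ : _ = 7); last by ring.
by [].
Qed.

End CountReduced.

(** Removing the content makes an element primitive modulo [Z]; the Bezout coefficients then
    complete it to a basis. *)
Lemma coprime_multiple (x y : int) : (x, y) != (0, 0) ->
  exists m x' y' u v : int, [/\ m != 0, x = m * x', y = m * y' & u * x' + v * y' = 1].
Proof.
move=> xy; have [u [v uv]] := Bezoutz x y; have m0 : gcdz x y != 0.
  by rewrite gcdz_eq0; move: xy; rewrite xpair_eqE.
have /dvdzP[x' Ex] := dvdz_gcdl x y; have /dvdzP[y' Ey] := dvdz_gcdr x y.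
exists (gcdz x y), x', y', u, v; split=> //; first by rewrite mulrC.
  by rewrite mulrC.
apply: (mulIf m0); rewrite mul1r -[RHS]uv mulrDl -!mulrA.
by rewrite -Ex -Ey.
Qed.

(** * The basis and the bounds attached to one field *)

Section FieldBounds.
Variable R : realType.
Variable Cst : R.
Variable f : {poly rat}.
Hypothesis cf : cubic f.
Hypothesis hyp : forall Z : R, 0 < Z -> cabs (discK R f) <= Z ->
  exists g, in_S f (Cst * powR Z (4%:R^-1)) g.

Lemma powR_quarter_sqr (D s : R) : 0 <= D -> 0 <= s -> s ^+ 2 = D ->
  powR D (4%:R^-1) ^+ 2 = s.
Proof.
move=> D0 s0 sD; apply/eqP; rewrite -(@eqrXn2 _ 2) ?sqr_ge0 // sD -exprM.
by rewrite -powR_mulrn ?powR_ge0 // -powRrM mulVf ?pnatr_eq0 // powRr1.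
Qed.

Lemma quarter_bound (D s T : R) : 0 <= D -> 0 <= s -> s ^+ 2 = D -> 0 <= T ->
  T <= 2 * (Cst * powR D (4%:R^-1)) -> T ^+ 2 <= 4 * Cst ^+ 2 * s.
Proof.
move=> D0 s0 sD T0 TD; rewrite -(powR_quarter_sqr D0 s0 sD).
have -> : 4 * Cst ^+ 2 * (powR D 4%:R^-1) ^+ 2 =
  (2 * (Cst * powR D (4%:R^-1))) ^+ 2 by ring.
by rewrite ler_pXn2r // nnegrE (le_trans T0).
Qed.

Lemma exists_reduced_pair : exists (z1 z2 z3 : R[i]) (D : nat) (g h : {poly rat}),
  [/\ conj_roots R f = [:: z1; z2; z3], roots3 f z1 z2 z3,
      cabs (discK R f) = D%:R & (0 < D)%N] /\
  [/\ min_pair f z1 z2 z3 g h, cabs (ev_det z1 z2 z3 g h) ^+ 2 = D%:R,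
      ev_diam z1 z2 z3 g ^+ 2 <= 4 * Cst ^+ 2 * cabs (ev_det z1 z2 z3 g h)
    & ev_diam z1 z2 z3 h <= (4 * Cst ^+ 2 + 2) * (cabs (ev_det z1 z2 z3 g h) / ev_diam z1 z2 z3 g)].
Proof.
have [z1 [z2 [z3 [Ez H]]]] := conj_rootsE R cf.
have [g [h mp]] := exists_min_pair cf H; have [Og Oh nz minP] := mp.
have [n En] := ev_det_sqr_int cf H Og Oh.
have ED : cabs (discK R f) = (absz n)%:R.
  by rewrite (discKE cf H Ez mp) En cabs_int -abszE.
have ns : cabs (ev_det z1 z2 z3 g h) ^+ 2 = (absz n)%:R.
  by rewrite expr2 -cabsM -expr2 En cabs_int -abszE.
have s0 : 0 < cabs (ev_det z1 z2 z3 g h) by rewrite cabs_gt0.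
have n0 : (0 < absz n)%N by rewrite -(ltr0n R) -ns exprn_gt0.
have D0 : 0 < (absz n)%:R :> R by rewrite ltr0n.
have [|k Sk] := hyp D0; first by rewrite ED.
have [sk Ok nZk _ _] := Sk.
have [r [x [y Ek]]] := min_pair_basis cf H mp (conj sk Ok).
have xy0 : (x, y) != (0, 0).
  apply/eqP => -[x0 y0]; apply: nZk; exists r.
  by rewrite Ek x0 y0 !scale0r !addr0.
have [m [x' [y' [u [v [m0 Ex Ey uv]]]]]] := coprime_multiple xy0.
pose al := x'%:~R *: g - (- y')%:~R *: h; pose be0 := u%:~R *: h - v%:~R *: g.
have Oal : isOK f al by exact (isOK_comb cf H x' (- y') Og Oh).
have Obe0 : isOK f be0 by exact (isOK_comb cf H u v Oh Og).
have Eal : k = (r%:~R)%:P + m%:~R *: al.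
  rewrite Ek Ex Ey /al scalerBr !scalerA !rmorphM rmorphN mulrN scaleNr opprK.
  by rewrite addrA.
have Edal : ev_det z1 z2 z3 al be0 = ev_det z1 z2 z3 g h.
  rewrite -[RHS]mul1r -(rmorph1 (intr : int -> R[i])) -uv rmorphD !rmorphM /=.
  rewrite /ev_det /al /be0 !evB !evZ !ratr_int rmorphN /=.
  by move: (ev z1 g) (ev z2 g) (ev z3 g) (ev z1 h) (ev z2 h) (ev z3 h) => *;
    rewrite /det3; ring.
clearbody al be0.
(* Minimality depends only on the value of the determinant, so unimodular changes of the pair
   preserve it. *)
have mp_of w : isOK f w -> ev_det z1 z2 z3 al w = ev_det z1 z2 z3 g h ->
  min_pair f z1 z2 z3 al w.
  by move=> Ow Ew; split; [exact: Oal|exact: Ow|rewrite Ew; exact: nz|rewrite Ew; exact: minP].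
have nzal : ev_det z1 z2 z3 al be0 != 0 by rewrite Edal.
have T0 : 0 < ev_diam z1 z2 z3 al.
  exact: (diam_gt0 cf H (proj1 Oal) (nonconst_d3l (proj1 Oal) (proj1 Obe0) nzal)).
have [j hj] := reduce_diam cf H be0 T0; rewrite Edal in hj.
pose be := 1%:~R *: be0 - j%:~R *: al.
have Obe : isOK f be by exact (isOK_comb cf H 1 j Obe0 Oal).
have beE : be = be0 - j%:~R *: al by rewrite /be scale1r.
clearbody be.
have Edbe : ev_det z1 z2 z3 al be = ev_det z1 z2 z3 g h.
  by rewrite beE -scaleNr ev_det_shift.
have Tk : ev_diam z1 z2 z3 al <= 2 * (Cst * powR (absz n)%:R (4%:R^-1)).
  apply: le_trans (in_S_diam Ez Sk).
  have [p [q [mp' mq ->]]] := diam_attained z1 z2 z3 al.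
  apply: le_trans (diam_ge k mp' mq).
  have Ekw (w : R[i]) : ev w k = r%:~R + m%:~R * ev w al.
    by rewrite Eal evD evC evZ !ratr_int.
  have -> : ev p k - ev q k = m%:~R * (ev p al - ev q al).
    by rewrite !Ekw; move: (ev p al) (ev q al) => ? ?; ring.
  rewrite cabsM cabs_int -abszE; apply: ler_peMl; first exact: cabs_ge0.
  by rewrite -[leLHS]/(1%:R) ler_nat lt0n absz_eq0.
have T2 : ev_diam z1 z2 z3 al ^+ 2 <= 4 * Cst ^+ 2 * cabs (ev_det z1 z2 z3 g h).
  exact: quarter_bound (ltW D0) (ltW s0) ns (diam_ge0 _ _ _ _) Tk.
exists z1, z2, z3, (absz n), al, be; rewrite Edbe.
split; [split; [exact: Ez|exact: H|exact: ED|exact: n0]|].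
split; [exact: mp_of|exact: ns|exact: T2|].
rewrite beE; apply: le_trans hj _.
(* The reduction gives [T + 2 s / T], and [T <= 4 Cst^2 s / T] by [T2]. *)
have -> : (4 * Cst ^+ 2 + 2) * (cabs (ev_det z1 z2 z3 g h) / ev_diam z1 z2 z3 al) =
  (4 * Cst ^+ 2 * cabs (ev_det z1 z2 z3 g h)) / ev_diam z1 z2 z3 al
   + 2 * cabs (ev_det z1 z2 z3 g h) / ev_diam z1 z2 z3 al by ring.
by rewrite lerD2r ler_pdivlMr.
Qed.

Lemma field_bounds : exists (D : nat) (s T : R) (F : int * int * int * int),
  let M := 4 * Cst ^+ 2 + 2 in let N := M + 4 in
  [/\ cabs (discK R f) = D%:R, (0 < D)%N, 0 < s, s ^+ 2 = D%:R & 1 <= T] /\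
  [/\ T ^+ 2 <= 4 * Cst ^+ 2 * s,
    forall Y l, T <= 2 * Y -> uniq l -> (forall g, g \in l -> in_S f Y g) ->
      (size l)%:R <= (48 + 64 * M) * (Y / T) * (Y * T / s + 1)
    & forall k : nat, k%:R * T <= 4 * (s / T) ->
      let: (a, b, c, d) := shift_form F k%:Z in
      [/\ represents R f (shift_form F k%:Z), d != 0 &
      [/\ `|a|%:~R <= T ^+ 3 / s, `|b|%:~R <= 3 * N * T,
        `|c|%:~R <= 3 * N ^+ 2 * (s / T) & `|d|%:~R <= N ^+ 3 * (s ^+ 2 / T ^+ 3)]]].
Proof.
have [z1 [z2 [z3 [D [g [h [[Ez H ED D0] [mp sD T2 hM]]]]]]]] := exists_reduced_pair.
set s := cabs _ in sD T2 hM; set T := ev_diam z1 z2 z3 g in T2 hM.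
have [[sg Og] [sh Oh] nz _] := mp.
have s0 : 0 < s by rewrite cabs_gt0.
have M0 : 0 <= 4 * Cst ^+ 2 + 2 :> R by rewrite addr_ge0 // mulr_ge0 // sqr_ge0.
have T0 : 0 < T by exact: (diam_gt0 cf H sg (nonconst_d3l sg sh nz)).
have s1 : 1 <= s.
  by rewrite leNgt -(expr_lt1 (isT : (0 < 2)%N) (ltW s0)) -leNgt sD ler1n; exact: D0.
have [F HF] := form_family cf H mp s1 M0 hM.
exists D, s, T, F => M N; split; first split=> //.
  (* The unshifted form has [a != 0], so [1 <= T^3 / s]; with [1 <= s] this forces [1 <= T]. *)
  have := HF 0%N; rewrite mul0r => /(_ _); case: F {HF} => [[[a b] c] d] /=.
  case=> [|[a0 _] _ [aT _ _ _]].
    by rewrite mulr_ge0 // divr_ge0 // ltW.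
  have {}aT : 1 <= T ^+ 3 / s.
    apply: le_trans aT; rewrite -abszE -[leLHS]/(1%:R) ler_nat lt0n absz_eq0.
    by [].
  rewrite leNgt; apply/negP => T1.
  have : T ^+ 3 < 1 by rewrite exprn_ilt1 // ltW.
  by rewrite ltNge; move: aT; rewrite ler_pdivlMr // mul1r => /(le_trans s1) ->.
split=> // Y l TY ul lS.
exact (count_in_S cf H Ez mp s0 M0 hM TY ul lS).
Qed.

End FieldBounds.

(** * Summation over fields *)

Section DyadicLevel.
Variable R : realType.

Definition level (x : R) : nat := trunc_log 2 (Num.truncn x).

Lemma level_bounds (x : R) : 1 <= x -> 2 ^+ level x <= x <= 2 * 2 ^+ level x.
Proof.
move=> x1; have x0 : 0 <= x by rewrite (le_trans ler01).
have t0 : (0 < Num.truncn x)%N by rewrite truncn_gt0.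
have /andP[l u] := trunc_log_bounds (isT : (1 < 2)%N) t0.
have /andP[tl tu] := truncn_itv x0.
rewrite -exprS -!natrX (le_trans _ tl) ?ler_nat //=.
by rewrite (le_trans (ltW tu)) // ler_nat.
Qed.

Lemma le_level (x y : R) : x <= y -> (level x <= level y)%N.
Proof. by move=> xy; apply/leq_trunc_log/le_truncn. Qed.

(** Logarithms are beaten by powers: [x^e] is at least [(1 + t)^level] with [1 + t = 2^e], and
    Bernoulli makes that at least [1 + level t]. *)
Lemma level_le_powR (e : R) : 0 < e ->
  exists2 c : R, 0 < c & forall x, 1 <= x -> (level x).+1%:R <= c * powR x e.
Proof.
move=> e0; pose t := powR 2 e - 1.
have t0 : 0 < t.
  have one : powR 1 e = 1 :> R by rewrite powR1.
  by rewrite subr_gt0 -[ltLHS]one gt0_ltr_powR ?nnegrE ?ler01 ?ler0n ?ltr1n.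
pose c : R := Num.min 1 t; have c0 : 0 < c by rewrite lt_min ltr01.
exists c^-1; first by rewrite invr_gt0.
move=> x x1; have x0 : 0 < x by rewrite (lt_le_trans ltr01).
have /andP[lx _] := level_bounds x1.
rewrite mulrC ler_pdivlMr //.
have P : powR (2 ^+ level x) e = (1 + t) ^+ level x.
  rewrite /t addrC subrK -powR_mulrn // -powRrM mulrC powRrM powR_mulrn //.
  exact: powR_ge0.
have : powR (2 ^+ level x) e <= powR x e.
  by apply: ge0_ler_powR => //; rewrite ?nnegrE ?exprn_ge0 // ltW.
rewrite P; apply: le_trans.
have bern n : 1 + n%:R * t <= (1 + t) ^+ n.
  elim: n => [|n IH]; first by rewrite mul0r addr0 expr0.
  rewrite exprS; apply: le_trans (ler_wpM2l _ IH); last by rewrite addr_ge0 // ltW.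
  rewrite -natr1; have : 0 <= n%:R * (t * t) by rewrite !mulr_ge0 // ltW.
  by lra.
apply: le_trans (bern _).
rewrite -natr1 mulrDl mul1r addrC lerD //.
  by rewrite /c ge_min lexx.
by rewrite ler_wpM2l // /c ge_min lexx orbT.
Qed.

End DyadicLevel.

(** * Counting the fields in one dyadic class *)

Section ClassCard.
Variable R : realType.
Variables (n : nat) (s T : 'I_n -> R) (Q : 'I_n -> int * int * int * int).
Variables (A L : R).
Hypotheses (A0 : 0 < A) (AL : A <= L) (L1 : 1 <= L).
Hypothesis s_gt0 : forall i, 0 < s i.
Hypothesis T_ge1 : forall i, 1 <= T i.
Hypothesis T_s : forall i, T i ^+ 2 <= A * s i.
Hypothesis Q_bounds : forall i (k : nat), k%:R * T i <= 4 * (s i / T i) ->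
  let: (a, b, c, d) := shift_form (Q i) k%:Z in
  [/\ a != 0, d != 0 & [/\ `|a|%:~R <= T i ^+ 3 / s i, `|b|%:~R <= 3 * L * T i,
     `|c|%:~R <= 3 * L ^+ 2 * (s i / T i) & `|d|%:~R <= L ^+ 3 * (s i ^+ 2 / T i ^+ 3)]].
Hypothesis Q_inj : forall i j (k l : nat), k%:R * T i <= 4 * (s i / T i) ->
  l%:R * T j <= 4 * (s j / T j) ->
  shift_form (Q i) k%:Z = shift_form (Q j) l%:Z -> i = j.

Lemma one_le_normz (a : int) : a != 0 -> 1 <= `|a|%:~R :> R.
Proof. by move=> a0; rewrite -abszE -[leLHS]/(1%:R) ler_nat lt0n absz_eq0. Qed.

(** In each factor the 3 is the passage from [2 B + 1] to [3 B]; the rest is the constant of the box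
    side for [a], [b], [c], [d] in turn. *)
Definition class_const : R :=
  (3 * 8) * (3 * (6 * L)) * (3 * (6 * L ^+ 2)) * (3 * (4 * L ^+ 3)).

(** Pairs of a field and a shift inject into a box of volume [<< g^2], and each field has at least
    [g / t^2] shifts. *)
Lemma class_card (P : pred 'I_n) (t g : R) : 1 <= t -> 0 < g ->
  (forall i, P i -> t <= T i <= 2 * t /\ g <= s i <= 2 * g) ->
  #|P|%:R <= class_const * (g * t ^+ 2).
Proof.
move=> t1 g0 HP; have t0 : 0 < t by rewrite (lt_le_trans ltr01).
have L0 : 0 < L by rewrite (lt_le_trans ltr01).
have [P0|] := posnP #|P|.
  by rewrite P0 !mulr_ge0 ?exprn_ge0 // ltW.
case/card_gt0P => i0 Pi0.
(* [K] is at least [g / t^2] and never zero. For [k < K], [k T^2 <= (g / t^2) (2 t)^2 = 4 g <= 4 s],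
   which is where the 4 in [Q_bounds] comes from. *)
have [K KE] : exists K, K = (Num.truncn (g / t ^+ 2)).+1 by eexists.
have gt0 : 0 <= g / t ^+ 2 by rewrite divr_ge0 ?exprn_ge0 // ltW.
have kT i k : P i -> (k < K)%N -> k%:R * T i <= 4 * (s i / T i).
  move=> Pi kK; have [/andP[tl tu] /andP[gl gu]] := HP i Pi.
  have Ti : 0 < T i by rewrite (lt_le_trans ltr01).
  rewrite mulrA ler_pdivlMr // -mulrA -expr2.
  have kg : k%:R <= g / t ^+ 2 by rewrite -truncn_ge_nat // -ltnS -KE.
  have T2 : T i ^+ 2 <= 4 * t ^+ 2.
    have -> : 4 * t ^+ 2 = (2 * t) ^+ 2 by ring.
    by rewrite ler_pXn2r ?nnegrE ?mulr_ge0 // ltW.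
  apply: le_trans (ler_pM _ _ kg T2) _; rewrite ?sqr_ge0 //.
  have -> : g / t ^+ 2 * (4 * t ^+ 2) = 4 * g by field; rewrite gt_eqF.
  by rewrite ler_pM2l.
pose Ba : R := 8 * (t ^+ 3 / g); pose Bb : R := 6 * L * t.
pose Bc : R := 6 * L ^+ 2 * (g / t); pose Bd : R := 4 * L ^+ 3 * (g ^+ 2 / t ^+ 3).
have bnd i k : P i -> (k < K)%N -> let: (a, b, c, d) := shift_form (Q i) k%:Z in
    [/\ a != 0, d != 0 & [/\ `|a|%:~R <= Ba, `|b|%:~R <= Bb,
        `|c|%:~R <= Bc & `|d|%:~R <= Bd]].
  move=> Pi kK; have := Q_bounds (kT i k Pi kK); case: (shift_form _ _) => [[[a b] c] d].
  have [/andP[tl tu] /andP[gl gu]] := HP i Pi.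
  have Ti : 0 < T i by rewrite (lt_le_trans ltr01).
  have si := s_gt0 i.
  have iT : (T i)^-1 <= t^-1 by rewrite lef_pV2.
  have is_ : (s i)^-1 <= g^-1 by rewrite lef_pV2.
  move=> [a0 d0 [ba bb bc bd]]; split=> //; split.
  - apply: le_trans ba _; rewrite /Ba mulrA.
    have -> : 8 * t ^+ 3 = (2 * t) ^+ 3 by ring.
    apply: ler_pM => //; [by rewrite exprn_ge0 // ltW|by rewrite invr_ge0 ltW|].
    by rewrite ler_pXn2r // nnegrE ?mulr_ge0 // ltW.
  - apply: le_trans bb _; rewrite /Bb.
    have -> : 6 * L * t = 3 * L * (2 * t) by ring.
    by rewrite ler_pM2l // mulr_gt0.
  - apply: le_trans bc _; rewrite /Bc.
    have -> : 6 * L ^+ 2 * (g / t) = 3 * L ^+ 2 * ((2 * g) / t) by ring.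
    rewrite ler_pM2l ?mulr_gt0 ?exprn_gt0 //.
    by apply: ler_pM => //; [exact: ltW|rewrite invr_ge0 ltW].
  - apply: le_trans bd _; rewrite /Bd.
    have -> : 4 * L ^+ 3 * (g ^+ 2 / t ^+ 3) = L ^+ 3 * ((2 * g) ^+ 2 / t ^+ 3) by ring.
    rewrite ler_pM2l ?exprn_gt0 //.
    apply: ler_pM; [by rewrite exprn_ge0 // ltW|by rewrite invr_ge0 exprn_ge0 // ltW| |].
      by rewrite ler_pXn2r // nnegrE ?mulr_ge0 // ltW.
    by rewrite lef_pV2 ?posrE ?exprn_gt0 // ler_pXn2r // nnegrE ltW.
pose box : seq (int * int * int * int) :=
  [seq (x, d) | x <- [seq (y, c) | y <- [seq (a, b) | a <- irange Ba, b <- irange Bb],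
     c <- irange Bc], d <- irange Bd].
pose l := [seq (i, k) | i <- enum P, k <- iota 0%N K].
have lP ik : ik \in l -> P ik.1 /\ (ik.2 < K)%N.
  by move=> /allpairsP[[i k] [/= iP kI ->]] /=; move: iP kI; rewrite mem_enum mem_iota.
have ul : uniq l by rewrite allpairs_uniq ?enum_uniq ?iota_uniq // => -[? ?] [? ?] _ _.
have sub : {subset map (fun ik => shift_form (Q ik.1) ik.2%:Z) l <= box}.
  move=> _ /mapP[[i k] /lP[/= Pi kK] ->].
  have := bnd i k Pi kK; case: (shift_form _ _) => [[[a b] c] d] [_ _ [ba bb bc bd]].
  by rewrite /box; do 3!(apply: allpairs_f; last exact: mem_irange); exact: mem_irange.
have inj : {in l &, injective (fun ik => shift_form (Q ik.1) ik.2%:Z)}.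
  move=> [i k] [j m] /lP[/= Pi kK] /lP[/= Pj mK] E.
  (* Equal forms come from the same field; then [b + 3 a k] with [a != 0] determines the shift. *)
  have ij := Q_inj (kT _ _ Pi kK) (kT _ _ Pj mK) E; subst j; congr (_, _).
  have := bnd i k Pi kK; move: E; case: (Q i) => [[[a b] c] d] [E _ _] [a0 _ _].
  move/eqP: E; rewrite (inj_eq (addrI b)) -subr_eq0 -mulrBr !mulf_eq0 (negPf a0) subr_eq0 /=.
  by rewrite eqz_nat => /eqP.
have := uniq_leq_size (_ : uniq [seq shift_form (Q ik.1) ik.2%:Z | ik <- l]) sub; rewrite map_inj_in_uniq // => /(_ ul).
rewrite size_map !size_allpairs size_iota -cardE -(ler_nat R) !natrM => le1.
(* One member of the class suffices: its nonzero integers [a] and [d] show that the outer sides of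
   the box are at least 1. *)
have [a [d [a0 d0 ba bd]]] : exists a d : int,
    [/\ a != 0, d != 0, `|a|%:~R <= Ba & `|d|%:~R <= Bd].
  have K0 : (0 < K)%N by rewrite KE.
  have := bnd i0 0%N Pi0 K0; case: (shift_form _ _) => [[[a b] c] d].
  by move=> [a0 d0 [ba _ _ bd]]; exists a, d.
have [_ /andP[tT _]] := HP i0 Pi0.
have b3 (B : R) : 1 <= B -> (size (irange B))%:R <= 3 * B.
  move=> B1; apply: le_trans (size_irange (le_trans ler01 B1)) _.
  by rewrite -subr_ge0 [leRHS](_ : _ = B - 1) ?subr_ge0 //; ring.
have Ba1 : 1 <= Ba by exact: le_trans (one_le_normz a0) ba.
have Bd1 : 1 <= Bd by exact: le_trans (one_le_normz d0) bd.
have Bb1 : 1 <= Bb by rewrite /Bb -[leLHS]mulr1 ler_pM // -[leLHS]mulr1 ler_pM // ler1n.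
have Bc1 : 1 <= Bc.
  have [/andP[tl tu] /andP[gl gu]] := HP i0 Pi0.
  have Ti0 := T_ge1 i0.
  have tT2 : t <= L * (2 * g).
    apply: le_trans tl _; apply: le_trans (_ : T i0 ^+ 2 <= _).
      by rewrite expr2 ler_peMr // (le_trans ler01).
    by apply: le_trans (T_s i0) _; apply: ler_pM => //; [exact: ltW|exact: ltW].
  rewrite /Bc mulrA ler_pdivlMr // mul1r; apply: le_trans tT2 _.
  have -> : 6 * L ^+ 2 * g = L * (2 * g) * (3 * L) by ring.
  apply: ler_peMr; first by rewrite ltW // mulr_gt0 // mulr_gt0.
  by apply: le_trans L1 _; rewrite ler_peMl ?ler1n // ltW.
have Kg : g / t ^+ 2 <= K%:R.
  by rewrite KE; have /andP[_ /ltW] := truncn_itv gt0.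
have le2 : #|P|%:R * (g / t ^+ 2) <= 3 * Ba * (3 * Bb) * (3 * Bc) * (3 * Bd).
  apply: le_trans (ler_wpM2l (ler0n _ _) Kg) _; apply: le_trans le1 _.
  by do 3!(apply: ler_pM; [by rewrite ?mulr_ge0|by []| |exact: b3]); exact: b3.
have gt1 : 0 < g / t ^+ 2 by rewrite divr_gt0 ?exprn_gt0.
rewrite -(ler_pM2r gt1); apply: le_trans le2 _.
rewrite le_eqVlt; apply/orP; left; apply/eqP.
by rewrite /class_const /Ba /Bb /Bc /Bd; field; rewrite !gt_eqF.
Qed.

End ClassCard.

(** * Summing the counts over dyadic classes *)

Section ClassSum.
Variable R : realType.
Variables (n : nat) (s T w : 'I_n -> R) (Q : 'I_n -> int * int * int * int).
Variables (A L Kc S Y : R).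
Hypotheses (A1 : 1 <= A) (AL : A <= L) (Kc0 : 0 <= Kc) (Y0 : 0 < Y).
Hypothesis s_ge1 : forall i, 1 <= s i.
Hypothesis T_ge1 : forall i, 1 <= T i.
Hypothesis T_s : forall i, T i ^+ 2 <= A * s i.
Hypothesis Q_bounds : forall i (k : nat), k%:R * T i <= 4 * (s i / T i) ->
  let: (a, b, c, d) := shift_form (Q i) k%:Z in
  [/\ a != 0, d != 0 & [/\ `|a|%:~R <= T i ^+ 3 / s i, `|b|%:~R <= 3 * L * T i,
     `|c|%:~R <= 3 * L ^+ 2 * (s i / T i) & `|d|%:~R <= L ^+ 3 * (s i ^+ 2 / T i ^+ 3)]].
Hypothesis Q_inj : forall i j (k l : nat), k%:R * T i <= 4 * (s i / T i) ->
  l%:R * T j <= 4 * (s j / T j) ->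
  shift_form (Q i) k%:Z = shift_form (Q j) l%:Z -> i = j.
Hypothesis w_bound : forall i, w i <= Kc * (Y / T i) * (Y * T i / s i + 1).
Hypothesis T_Y : forall i, T i <= 2 * Y.
Hypothesis s_S : forall i, s i <= S.

Let A0 : 0 < A := lt_le_trans ltr01 A1.
Let s_gt0 i : 0 < s i := lt_le_trans ltr01 (s_ge1 i).
Let L1 : 1 <= L := le_trans A1 AL.

Definition sum_const : R := class_const L * Kc * (2 * A + 2).

Lemma class_const_ge0 : 0 <= class_const L.
Proof.
have L0 : 0 <= L by exact: le_trans ler01 L1.
by rewrite /class_const !mulr_ge0 // exprn_ge0.
Qed.

(** The number of fields times the bound per field is [<< t^2 Y^2 + g t Y]. Here [t^2 <= A S]
    controls the first term, [g <= S] and [t <= 2 Y] the second; the two give [2 A + 2]. *)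
Lemma class_sum (P : pred 'I_n) (t g : R) : 1 <= t -> 0 < g -> 0 <= S ->
  (forall i, P i -> t <= T i <= 2 * t /\ g <= s i <= 2 * g) ->
  \sum_(i | P i) w i <= sum_const * (S * Y ^+ 2).
Proof.
move=> t1 g0 S0 HP; have t0 : 0 < t by rewrite (lt_le_trans ltr01).
have cc0 := class_const_ge0.
have [i0 Pi0|P0] := pickP P; last first.
  rewrite big_pred0 //.
  have A20 : 0 <= 2 * A + 2 by rewrite addr_ge0 // mulr_ge0 // ltW.
  exact: mulr_ge0 (mulr_ge0 (mulr_ge0 cc0 Kc0) A20) (mulr_ge0 S0 (sqr_ge0 Y)).
pose W : R := Kc * (Y / t) * (2 * (Y * t / g) + 1).
have wW i : P i -> w i <= W.
  move=> Pi; have [/andP[tl tu] /andP[gl gu]] := HP i Pi.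
  have Ti : 0 < T i by rewrite (lt_le_trans ltr01).
  have si := s_gt0 i; have iT : (T i)^-1 <= t^-1 by rewrite lef_pV2.
  have is_ : (s i)^-1 <= g^-1 by rewrite lef_pV2.
  have p1 : 0 <= Y / T i by rewrite divr_ge0 ?ltW.
  have p2 : 0 <= Y * T i / s i by rewrite divr_ge0 ?mulr_ge0 ?ltW.
  apply: le_trans (w_bound i) _; apply: ler_pM.
  - exact: mulr_ge0.
  - by rewrite addr_ge0.
  - by rewrite ler_wpM2l // ler_pM2l.
  - rewrite lerD2r.
    have -> : 2 * (Y * t / g) = (Y * (2 * t)) / g by ring.
    apply: ler_pM; [by rewrite mulr_ge0 ?ltW|by rewrite invr_ge0 ltW| |by []].
    by rewrite ler_pM2l.
have W0 : 0 <= W.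
  by rewrite /W !mulr_ge0 ?addr_ge0 ?mulr_ge0 ?invr_ge0 // ltW.
apply: le_trans (ler_sum _ wW) _; rewrite sumr_const -mulr_natl.
have cardP : #|P|%:R <= class_const L * (g * t ^+ 2).
  have := class_card A0 AL L1 s_gt0 T_ge1 T_s Q_bounds Q_inj t1 g0 HP; exact.
apply: le_trans (ler_wpM2r W0 cardP) _.
have [/andP[tl tu] /andP[gl gu]] := HP i0 Pi0.
have gS : g <= S by exact: le_trans gl (s_S i0).
have tY : t <= 2 * Y by exact: le_trans tl (T_Y i0).
have t2 : t ^+ 2 <= A * S.
  apply: le_trans (_ : T i0 ^+ 2 <= _); first by rewrite ler_pXn2r // nnegrE ?ltW // (lt_le_trans t0).
  by apply: le_trans (T_s i0) _; rewrite ler_pM2l.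
have -> : class_const L * (g * t ^+ 2) * W =
    class_const L * Kc * (2 * (t ^+ 2 * Y ^+ 2) + g * t * Y).
  by rewrite /W; field; rewrite !gt_eqF.
rewrite /sum_const -[leRHS]mulrA; apply: ler_wpM2l; first exact: mulr_ge0.
have -> : (2 * A + 2) * (S * Y ^+ 2) = 2 * (A * S * Y ^+ 2) + S * (2 * Y) * Y by ring.
apply: lerD; first by rewrite ler_pM2l // ler_wpM2r // sqr_ge0.
by rewrite ler_pM2r // ler_pM // ltW.
Qed.

(** Both [T <= T^2 <= A s] and [s] are at most [A S], so each has at most [level (A * S) + 1] dyadic
    levels. *)
Lemma total_sum : 1 <= S ->
  \sum_i w i <= (level (A * S)).+1%:R ^+ 2 * (sum_const * (S * Y ^+ 2)).
Proof.
move=> S1; set m := level (A * S); have S0 : 0 <= S by exact: le_trans ler01 S1.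
have lT i : (level (T i) < m.+1)%N.
  rewrite ltnS; apply: le_level.
  apply: le_trans (_ : T i ^+ 2 <= _); first by rewrite expr2 ler_peMr // (le_trans ler01).
  by apply: le_trans (T_s i) _; rewrite ler_pM2l.
have ls i : (level (s i) < m.+1)%N.
  rewrite ltnS; apply: le_level; apply: le_trans (s_S i) _.
  by rewrite ler_peMl.
pose lev i : 'I_m.+1 * 'I_m.+1 := (inord (level (T i)), inord (level (s i))).
rewrite (partition_big lev predT) //=.
apply: le_trans (ler_sum _ (_ : forall x, true -> _ <= sum_const * (S * Y ^+ 2))) _.
  move=> [j e] _; apply: (@class_sum _ (2 ^+ j) (2 ^+ e)) => //.
  - by rewrite exprn_ege1 // ler1n.
  - by rewrite exprn_gt0.
  move=> i /eqP[Ej Ee].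
  have <- : level (T i) = j by rewrite -Ej inordK.
  have <- : level (s i) = e by rewrite -Ee inordK.
  by split; apply: level_bounds.
by rewrite sumr_const card_prod !card_ord -[leLHS]mulr_natl natrM -expr2.
Qed.

End ClassSum.

Theorem theorem3p8 (R : realType) (C : R) (hC : 1 < C)
  (hyp : forall Z : R, 0 < Z -> forall f : {poly rat}, cubic f ->
           cabs (discK R f) <= Z -> exists g, in_S f (C * powR Z (4%:R^-1)) g)
  (eps : R) (heps : 0 < eps) :
  exists c : R, 0 < c /\
    forall X Y : R, 0 < X -> 0 < Y -> C * powR X (4%:R^-1) <= Y ->
    forall F : seq ({poly rat} * seq {poly rat}),
      (forall p, p \in F ->
         [/\ cubic p.1, cabs (discK R p.1) <= X, uniq p.2
           & forall g, g \in p.2 -> in_S p.1 Y g]) ->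
      (forall i j : nat, (i < j < size F)%N ->
         ~ iso_fields (nth (0, [::]) F i).1 (nth (0, [::]) F j).1) ->
      \sum_(p <- F) (size p.2)%:R <= c * powR X (2%:R^-1 + eps) * Y ^+ 2.
Proof.
pose A : R := 4 * C ^+ 2; pose M : R := A + 2; pose L : R := M + 4.
pose Kc : R := 48 + 64 * M.
have C2 : 1 <= C ^+ 2 by rewrite exprn_ege1 // ltW.
have A1 : 1 <= A by rewrite /A; move: C2; lra.
have AL : A <= L by rewrite /L /M; lra.
have Kc0 : 0 < Kc by rewrite /Kc /M; move: A1; lra.
have L1 : 1 <= L by exact: le_trans AL.
have A0 : 0 < A by exact: lt_le_trans A1.
have [c0 c0_gt0 Hc0] := level_le_powR heps.
have sc0 : 0 < sum_const A L Kc.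
  have L0 : 0 < L by exact: lt_le_trans L1.
  by rewrite /sum_const /class_const !mulr_gt0 ?exprn_gt0 // addr_gt0 // mulr_gt0.
have cp : 0 < c0 ^+ 2 * powR A eps ^+ 2 * sum_const A L Kc.
  by apply: mulr_gt0 => //; apply: mulr_gt0; rewrite exprn_gt0 ?powR_gt0.
exists (c0 ^+ 2 * powR A eps ^+ 2 * sum_const A L Kc); split=> // X Y X0 Y0 XY F HF Hiso.
have FP (i : 'I_(size F)) := HF _ (mem_nth (0, [::]) (ltn_ord i)).
pose fld (i : 'I_(size F)) := (nth (0, [::]) F i).1.
have dat (i : 'I_(size F)) := @field_bounds R C (fld i)
  (let: And4 cf _ _ _ := FP i in cf)
  (fun Z Z0 DZ => hyp Z Z0 (fld i) (let: And4 cf _ _ _ := FP i in cf) DZ).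
have /choice[D /choice[s /choice[T /choice[Q HQ]]]] := dat.
(* A field in the list has a nonzero integer discriminant, so a nonempty list forces [1 <= X]. *)
have [F0|F_gt0] := posnP (size F).
  rewrite (size0nil F0) big_nil.
  exact: mulr_ge0 (mulr_ge0 (ltW cp) (powR_ge0 _ _)) (sqr_ge0 Y).
have DX i : (D i)%:R <= X.
  by have [[<- _ _ _ _] _] := HQ i; have [_ ? _ _] := FP i.
have s_gt0 i : 0 < s i by have [[]] := HQ i.
have s2 i : s i ^+ 2 = (D i)%:R by have [[]] := HQ i.
have T_ge1 i : 1 <= T i by have [[]] := HQ i.
have T_s i : T i ^+ 2 <= A * s i by have [_ []] := HQ i.
have s_ge1 i : 1 <= s i.
  have [[_ D0 _ _ _] _] := HQ i.
  by rewrite leNgt -(expr_lt1 (isT : (0 < 2)%N) (ltW (s_gt0 i))) -leNgt s2 ler1n.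
have X1 : 1 <= X.
  apply: le_trans (DX (Ordinal F_gt0)); rewrite -s2.
  by rewrite exprn_ege1.
pose S : R := powR X (2^-1).
have S2 : S ^+ 2 = X.
  by rewrite /S powR12_sqrt ?ltW // sqr_sqrtr // ltW.
have S0 : 0 < S by rewrite powR_gt0.
have s_S i : s i <= S.
  by rewrite -(@ler_pXn2r _ 2) ?nnegrE ?(ltW S0) ?(ltW (s_gt0 i)) // S2 s2.
have S1 : 1 <= S by exact: le_trans (s_ge1 (Ordinal F_gt0)) (s_S _).
(* The lower bound on [Y] enters here: [T^2 <= A s <= A S = (2 C X^(1/4))^2 <= (2 Y)^2]. *)
have T_Y i : T i <= 2 * Y.
  have q : powR X (4%:R^-1) ^+ 2 = S.
    exact: powR_quarter_sqr (ltW X0) (ltW S0) S2.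
  have C0 : 0 < C by exact: lt_trans hC.
  rewrite -(@ler_pXn2r _ 2) ?nnegrE ?(le_trans ler01 (T_ge1 i)) ?mulr_ge0 ?(ltW Y0) //.
  apply: le_trans (T_s i) _; apply: le_trans (_ : (2 * (C * powR X (4%:R^-1))) ^+ 2 <= _).
    have -> : (2 * (C * powR X (4%:R^-1))) ^+ 2 = A * powR X (4%:R^-1) ^+ 2.
      by rewrite /A; ring.
    by rewrite q ler_pM2l.
  have p0 : 0 <= C * powR X (4%:R^-1) by rewrite mulr_ge0 ?powR_ge0 ?ltW.
  have q0 : 0 <= 2 * (C * powR X (4%:R^-1)) by exact: mulr_ge0.
  have qY : 2 * (C * powR X (4%:R^-1)) <= 2 * Y by rewrite ler_pM2l.
  by rewrite ler_pXn2r ?nnegrE ?(le_trans q0 qY).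
pose w (i : 'I_(size F)) : R := (size (nth (0, [::]) F i).2)%:R.
have w_bound i : w i <= Kc * (Y / T i) * (Y * T i / s i + 1).
  have [_ [_ H _]] := HQ i; have [_ _ ul lS] := FP i.
  exact: H (T_Y i) ul lS.
have Q_rep i (k : nat) : k%:R * T i <= 4 * (s i / T i) ->
    represents R (fld i) (shift_form (Q i) k%:Z).
  by move=> kT; have [_ [_ _ /(_ k kT)]] := HQ i; case: (shift_form _ _) => [[[a b] c] d] [].
have Q_bounds i (k : nat) : k%:R * T i <= 4 * (s i / T i) ->
  let: (a, b, c, d) := shift_form (Q i) k%:Z in
  [/\ a != 0, d != 0 & [/\ `|a|%:~R <= T i ^+ 3 / s i, `|b|%:~R <= 3 * L * T i,
     `|c|%:~R <= 3 * L ^+ 2 * (s i / T i) & `|d|%:~R <= L ^+ 3 * (s i ^+ 2 / T i ^+ 3)]].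
  move=> kT; have [_ [_ _ /(_ k kT)]] := HQ i.
  by case: (shift_form _ _) => [[[a b] c] d] [[a0 _] d0 bd].
have Q_inj i j (k l : nat) : k%:R * T i <= 4 * (s i / T i) ->
    l%:R * T j <= 4 * (s j / T j) ->
    shift_form (Q i) k%:Z = shift_form (Q j) l%:Z -> i = j.
  move=> /Q_rep ri /Q_rep rj E; rewrite E in ri.
  have [ci _ _ _] := FP i; have [cj _ _ _] := FP j.
  apply/val_inj; case: (ltngtP i j) => // ij; exfalso.
    by apply: (Hiso i j); rewrite ?ij ?ltn_ord //; apply: represents_iso ci cj ri rj.
  by apply: (Hiso j i); rewrite ?ij ?ltn_ord //; apply: represents_iso cj ci rj ri.
have := total_sum A1 AL (ltW Kc0) Y0 s_ge1 T_ge1 T_s Q_bounds Q_inj w_bound T_Y s_S S1.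
rewrite (big_nth (0, [::])) big_mkord => /le_trans; apply.
have AS1 : 1 <= A * S by rewrite -[leLHS]mulr1 ler_pM.
have lb := Hc0 _ AS1.
have SX : powR S eps ^+ 2 = powR X eps by rewrite expr2 -powRM ?ltW // -expr2 S2.
(* Each of the two logarithmic factors costs [(A S)^eps]; as [S^2 = X], together they cost exactly
   [X^eps] up to a constant. *)
have m2 : (level (A * S)).+1%:R ^+ 2 <= c0 ^+ 2 * powR A eps ^+ 2 * powR X eps.
  apply: le_trans (_ : (c0 * powR (A * S) eps) ^+ 2 <= _).
    by rewrite ler_pXn2r // nnegrE ?mulr_ge0 ?powR_ge0 // ltW.
  by rewrite (powRM _ (ltW A0) (ltW S0)) -SX !exprMn mulrA.
apply: le_trans (ler_wpM2r _ m2) _; 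
  first exact: mulr_ge0 (ltW sc0) (mulr_ge0 (ltW S0) (sqr_ge0 Y)).
rewrite powRD; last by rewrite (gt_eqF X0) implybT.
by rewrite -/S le_eqVlt; apply/orP; left; apply/eqP; ring.
Qed.
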